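(* Let $\boldsymbol{x}_1,\dots,\boldsymbol{x}_T\in\mathbb{R}^{N_x}$ be inputs with labels $y_1,\dots,y_T\in\{1,\dots,N_y\}$. Fix $\boldsymbol{\theta}$ and write $\boldsymbol{\phi}_t:=\boldsymbol{\phi}(\boldsymbol{x}_t,\boldsymbol{\theta})\in\mathbb{R}^{N_\phi}$. Consider the generative classification model with parameters $\boldsymbol{\xi}=\{\boldsymbol{\mu},\boldsymbol{\rho}\}$, $\boldsymbol{\mu}=\{\boldsymbol{\mu}_1,\dots,\boldsymbol{\mu}_{N_y}\}$, given by $$\boldsymbol{\rho}\sim\mathrm{Dir}(\underline{\boldsymbol{\alpha}}),\qquad \boldsymbol{\mu}_k\sim\mathcal{N}(\underline{\bar{\boldsymbol{\mu}}}_k,\underline{S}_k)\ (k=1,\dots,N_y),\qquad y\mid\boldsymbol{\rho}\sim\mathrm{Cat}(\boldsymbol{\rho}),\qquad \boldsymbol{\phi}\mid y,\boldsymbol{\mu}\sim\mathcal{N}(\boldsymbol{\mu}_y,\Sigma),$$ with $\boldsymbol{\rho},\boldsymbol{\mu}_1,\dots,\boldsymbol{\mu}_{N_y}$ independent under the prior $p(\boldsymbol{\xi})$. Let $q(\boldsymbol{\mu}\mid\boldsymbol{\eta})=\prod_{k=1}^{N_y}\mathcal{N}(\bar{\boldsymbol{\mu}}_k,S_k)$ be the variational posterior over class embeddings, let $p(\boldsymbol{\rho}\mid Y)=\mathrm{Dir}(\boldsymbol{\alpha})$ be the exact Dirichlet posterior over class probabilities, with concentration parameters $\boldsymbol{\alpha}=(\alpha_1,\dots,\alpha_{N_y})$,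 and let $q(\boldsymbol{\xi}\mid\boldsymbol{\eta})=q(\boldsymbol{\mu}\mid\boldsymbol{\eta})\,p(\boldsymbol{\rho}\mid Y)$. Then $$\frac1T\log p(Y\mid X,\boldsymbol{\theta})\;\ge\;\mathcal{L}(\boldsymbol{\theta},\boldsymbol{\eta},\Sigma)-\frac1T\,\mathrm{KL}\big(q(\boldsymbol{\xi}\mid\boldsymbol{\eta})\,\|\,p(\boldsymbol{\xi})\big),$$ where $$\mathcal{L}(\boldsymbol{\theta},\boldsymbol{\eta},\Sigma)=\frac1T\sum_{t=1}^T\Big(\log\mathcal{N}(\boldsymbol{\phi}_t\mid\bar{\boldsymbol{\mu}}_{y_t},\Sigma)-\tfrac12\mathrm{tr}(\Sigma^{-1}S_{y_t})+\psi(\alpha_{y_t})-\psi(\alpha_* )+\log\alpha_*-\mathrm{LSE}_k\big[\log\mathcal{N}(\boldsymbol{\phi}_t\mid\bar{\boldsymbol{\mu}}_k,\Sigma+S_k)+\log\alpha_k\big]\Big),$$ $\psi$ is the digamma function and $\alpha_*=\sum_{k=1}^{N_y}\alpha_k$.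
   Context: $\boldsymbol{\phi}:\mathbb{R}^{N_x}\times\Theta\to\mathbb{R}^{N_\phi}$ is an arbitrary fixed feature map (a neural network without its last layer, with weights $\boldsymbol{\theta}\in\Theta$). $X,Y$ denote the stacked inputs and labels. $\mathcal{N}(\cdot\mid m,C)$ is the Gaussian density with mean $m$ and covariance $C$; $\Sigma,S_k,\underline{S}_k\in\mathbb{R}^{N_\phi\times N_\phi}$ are symmetric positive definite; $\underline{\boldsymbol{\alpha}}\in(0,\infty)^{N_y}$ are prior Dirichlet concentrations, and by conjugacy $\alpha_k=\underline{\alpha}_k+\#\{t: y_t=k\}$. $\mathrm{LSE}_k[a_k]=\log\sum_{k=1}^{N_y}e^{a_k}$. $\boldsymbol{\eta}$ collects the parameters of the variational posterior. The likelihood of an input given its class is identified with the feature density, so given $\boldsymbol{\xi}$ Bayes' rule yields $p(y\mid\boldsymbol{x}_t,\boldsymbol{\xi},\boldsymbol{\theta})=\rho_y\,\mathcal{N}(\boldsymbol{\phi}_t\mid\boldsymbol{\mu}_y,\Sigma)\big/\sum_{k=1}^{N_y}\rho_k\,\mathcal{N}(\boldsymbol{\phi}_t\mid\boldsymbol{\mu}_k,\Sigma)$. The marginal likelihood is $p(Y\mid X,\boldsymbol{\theta})=\mathbb{E}_{\boldsymbol{\xi}\sim p(\boldsymbol{\xi})}\big[\prod_{t=1}^T p(y_t\mid\boldsymbol{x}_t,\boldsymbol{\xi},\boldsymbol{\theta})\big]$. $\mathrm{KL}$ denotes Kullback--Leibler divergence. *)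

(* Defs.v *)
From HB Require Import structures.
From mathcomp Require Import all_boot all_order all_algebra.
From mathcomp Require Import all_classical all_reals all_analysis.
From mathcomp Require Import measurable_realfun.

Set Implicit Arguments.
Unset Strict Implicit.
Unset Printing Implicit Defensive.

Import Order.TTheory GRing.Theory Num.Theory.
Import numFieldNormedType.Exports.

Local Open Scope classical_set_scope.
Local Open Scope ring_scope.

Section tuple_product_measure.
Local Open Scope ereal_scope.
Context d (T : measurableType d) (R : realType).
Variable m : {sigma_finite_measure set T -> \bar R}.

Section step.
Variables (n : nat) (mn : {sigma_finite_measure set (n.-tuple T) -> \bar R}).

Definition tuple_uncons (v : n.+1.-tuple T) : T * n.-tuple T :=
  (thead v, [tuple of behead v]).

Definition tuple_cons (p : T * n.-tuple T) : n.+1.-tuple T :=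
  [tuple of p.1 :: p.2].

Definition tuple_cons_measure : set (n.+1.-tuple T) -> \bar R :=
  pushforward (m \x mn) tuple_cons.

Lemma measurable_tuple_cons : measurable_fun setT tuple_cons.
Proof. exact: measurable_cons. Qed.

Lemma measurable_tuple_uncons : measurable_fun setT tuple_uncons.
Proof.
apply: measurable_fun_pair; last exact: measurable_behead.
exact: (measurable_tnth ord0).
Qed.

Lemma tuple_consK : cancel tuple_cons tuple_uncons.
Proof. by case=> a v; congr pair; exact/val_inj. Qed.

Lemma tuple_unconsK : cancel tuple_uncons tuple_cons.
Proof. by move=> v; rewrite [RHS]tuple_eta. Qed.

Let tcm0 : tuple_cons_measure set0 = 0.
Proof. by rewrite /tuple_cons_measure /pushforward preimage_set0 measure0. Qed.

Let tcm_ge0 A : 0 <= tuple_cons_measure A.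
Proof. by rewrite /tuple_cons_measure /pushforward measure_ge0. Qed.

Let tcm_sigma_additive : semi_sigma_additive tuple_cons_measure.
Proof.
have mc (A : set (n.+1.-tuple T)) :
    measurable A -> measurable (tuple_cons @^-1` A).
  by move=> mA; rewrite -[X in measurable X]setTI; exact: measurable_tuple_cons.
move=> F mF tF mUF; rewrite /tuple_cons_measure /pushforward preimage_bigcup.
apply: measure_semi_sigma_additive.
- by move=> i; exact: mc.
- apply/trivIsetP => /= i j _ _ ij; rewrite -preimage_setI.
  by move/trivIsetP : tF => /(_ _ _ _ _ ij) ->//; rewrite preimage_set0.
- by rewrite -preimage_bigcup; exact: mc.
Qed.

HB.instance Definition _ := isMeasure.Build _ _ _ tuple_cons_measure
  tcm0 tcm_ge0 tcm_sigma_additive.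

Let tcm_sigma_finite : sigma_finite setT tuple_cons_measure.
Proof.
have /sigma_finiteP[F [FT ndF mF]] := sigma_finiteT m.
have /sigma_finiteP[G [GT ndG mG]] := sigma_finiteT mn.
exists (fun i => tuple_uncons @^-1` (F i `*` G i)).
  rewrite -preimage_bigcup (_ : \bigcup_i _ = setT) ?preimage_setT//.
  rewrite -subTset => -[u v] _.
  have [i _ Fiu] : (\bigcup_i F i) u by rewrite -FT.
  have [j _ Gjv] : (\bigcup_i G i) v by rewrite -GT.
  exists (maxn i j) => //; split => /=.
    by move: u Fiu; exact/subsetPset/ndF/leq_maxl.
  by move: v Gjv; exact/subsetPset/ndG/leq_maxr.
move=> i; have [mFi Fi] := mF i; have [mGi Gi] := mG i; split.
  rewrite -[X in measurable X]setTI.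
  by apply: measurable_tuple_uncons => //; exact: measurableX.
rewrite /= /tuple_cons_measure /pushforward -comp_preimage.
rewrite (_ : _ \o _ = id) ?preimage_id; last first.
  by apply/funext => p /=; rewrite tuple_consK.
by rewrite product_measure1E// lte_mul_pinfty// ge0_fin_numE.
Qed.

HB.instance Definition _ := Measure_isSigmaFinite.Build _ _ _
  tuple_cons_measure tcm_sigma_finite.

End step.

(* The n-fold product measure m x ... x m on n.-tuple T; the 0-fold product
   is the unit mass on the empty tuple. *)
Fixpoint tuple_measure (n : nat) :
    {sigma_finite_measure set (n.-tuple T) -> \bar R} :=
  match n with
  | 0 => dirac [tuple]
  | n'.+1 => tuple_cons_measure (tuple_measure n')
  end.

End tuple_product_measure.

(* R^n as a measurable type: measurableTypeR R is R with the Borel sigma-algebra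
   on which lebesgue_measure is declared. *)
Notation Rvec R n := (n.-tuple (measurableTypeR R)).

Section distributions.
Context (R : realType).
Local Notation leb := (@lebesgue_measure R).

(* Lebesgue measure on R^n, and on R^(n x K) seen as K-tuples of vectors. *)
Definition lebesgue_vec (n : nat) := tuple_measure leb n.
Definition lebesgue_vecs (n K : nat) := tuple_measure (lebesgue_vec n) K.

Definition vec_of n (v : Rvec R n) : 'cV[R]_n := \col_i tnth v i.

Definition sym_posdef n (C : 'M[R]_n) : Prop :=
  C^T = C /\ forall v : 'cV[R]_n, v != 0 -> 0 < (v^T *m C *m v) 0 0.

Definition gauss_pdf n (m : 'cV[R]_n) (C : 'M[R]_n) (v : 'cV[R]_n) : R :=
  (Num.sqrt ((2 * pi) ^+ n * \det C))^-1 *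
  expR (- ((v - m)^T *m invmx C *m (v - m)) 0 0 / 2).

Definition Gamma (a : R) : R :=
  \int[leb]_(t in `]0, +oo[) (t `^ (a - 1) * expR (- t)).

Definition digamma (a : R) : R := (fun s => ln (Gamma s))^`()%classic a.

(* The simplex point with free coordinates r = (r_0, ..., r_(K-2)): the last
   coordinate, reached through the default value of nth, is 1 minus their sum.
   For K = 1 the tuple r is empty and the simplex is the single point 1. *)
Definition simplex_pt K (r : Rvec R K.-1) (k : 'I_K) : R :=
  nth (1 - \sum_(s <- r) (s : R)) r k.

(* Density of Dir(a) with respect to Lebesgue measure on the K - 1 free
   coordinates; it vanishes off the open simplex. *)
Definition dirichlet_pdf K (a : 'I_K -> R) (r : Rvec R K.-1) : R :=
  if [forall k, 0 < simplex_pt r k] then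
    Gamma (\sum_k a k) / (\prod_k Gamma (a k)) *
    \prod_k simplex_pt r k `^ (a k - 1)
  else 0.

(* KL(q || p) for densities q, p with respect to mu: 0 log (0 / p) = 0, and
   q log (q / 0) = +oo when q > 0. *)
Definition kl_div d (X : measurableType d) (mu : {measure set X -> \bar R})
    (q p : X -> R) : \bar R :=
  (\int[mu]_x (if q x == 0%R then 0
               else if p x == 0%R then +oo
               else (q x * ln (q x / p x))%:E))%E.

Definition LSE K (a : 'I_K -> R) : R := ln (\sum_k expR (a k)).

End distributions.

Section model.
Context (R : realType) (Nphi Ny : nat).

(* A value of xi = (rho, mu): the free coordinates of rho, and the class
   means mu_1, ..., mu_Ny. *)
Definition param : Type := Rvec R Ny.-1 * Ny.-tuple (Rvec R Nphi).

Definition rho_of (xi : param) (k : 'I_Ny) : R := simplex_pt xi.1 k.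
Definition mu_of (xi : param) (k : 'I_Ny) : 'cV[R]_Nphi :=
  vec_of (tnth xi.2 k).

Definition param_measure :
    {measure set (Rvec R Ny.-1 * Ny.-tuple (Rvec R Nphi)) -> \bar R} :=
  (lebesgue_vec R Ny.-1 \x lebesgue_vecs R Nphi Ny)%E.

(* Density of Dir(a) x N(m_1, C_1) x ... x N(m_Ny, C_Ny), i.e. with rho and
   the mu_k independent. *)
Definition param_pdf (a : 'I_Ny -> R) (m : 'I_Ny -> 'cV[R]_Nphi)
    (C : 'I_Ny -> 'M[R]_Nphi) (xi : param) : R :=
  dirichlet_pdf a xi.1 * \prod_k gauss_pdf (m k) (C k) (mu_of xi k).

Definition joint_pdf (Sigma : 'M[R]_Nphi) (xi : param) (f : 'cV[R]_Nphi)
    (k : 'I_Ny) : R :=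
  rho_of xi k * gauss_pdf (mu_of xi k) Sigma f.

Definition class_prob (Sigma : 'M[R]_Nphi) (xi : param) (f : 'cV[R]_Nphi)
    (k : 'I_Ny) : R :=
  joint_pdf Sigma xi f k / \sum_j joint_pdf Sigma xi f j.

Definition marginal_likelihood T (prior : param -> R) (Sigma : 'M[R]_Nphi)
    (f : 'I_T -> 'cV[R]_Nphi) (y : 'I_T -> 'I_Ny) : \bar R :=
  (\int[param_measure]_xi
     ((\prod_(t < T) class_prob Sigma xi (f t) (y t)) * prior xi)%:E)%E.

Definition posterior_conc T (a : 'I_Ny -> R) (y : 'I_T -> 'I_Ny)
    (k : 'I_Ny) : R :=
  a k + #|[pred t | y t == k]|%:R.

Definition elbo_term (Sigma : 'M[R]_Nphi) (m : 'I_Ny -> 'cV[R]_Nphi)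
    (C : 'I_Ny -> 'M[R]_Nphi) (a : 'I_Ny -> R) (f : 'cV[R]_Nphi)
    (k : 'I_Ny) : R :=
  let a_sum := \sum_j a j in
  ln (gauss_pdf (m k) Sigma f) - 2^-1 * \tr (invmx Sigma *m C k)
  + digamma (a k) - digamma a_sum + ln a_sum
  - LSE (fun j => ln (gauss_pdf (m j) (Sigma + C j) f) + ln (a j)).

Definition elbo_likelihood T (Sigma : 'M[R]_Nphi) (m : 'I_Ny -> 'cV[R]_Nphi)
    (C : 'I_Ny -> 'M[R]_Nphi) (a : 'I_Ny -> R) (f : 'I_T -> 'cV[R]_Nphi)
    (y : 'I_T -> 'I_Ny) : R :=
  T%:R^-1 * \sum_(t < T) elbo_term Sigma m C a (f t) (y t).

End model.

(* Main.v *)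
(* With L the likelihood, Gibbs' inequality ln u <= u - 1 at u = L p / (z q)
   gives q (ln L - ln z + 1) - L p / z <= q ln (q / p) pointwise, and integrating
   with z the evidence yields E_q[ln L] - KL <= ln p(Y | X).  The log-sum in the
   denominator of ln L is linearized in the same way around its mean under q.
   What remains are three moments under q.  The mean of the mixture density is a
   convolution of Gaussians (complete the square).  The mean of -ln rho_k is at
   most the quotient (E[rho_k ^ (-e)] - 1) / e for all e > 0, and Dirichlet
   moments are quotients of Gamma values, so e -> 0 gives the digamma terms.
   The quadratic moment comes by monotone convergence from X exp (-t X) <=
   (1 - exp (-t X)) / t, whose mean is a normalization constant governed by
   det (1 + t S Sigma^-1) = 1 + t tr (S Sigma^-1) + O(t ^ 2). *)
Require Import Defs.
From HB Require Import structures.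
From mathcomp Require Import all_boot all_order all_algebra.
From mathcomp Require Import all_classical all_reals all_analysis.
From mathcomp Require Import measurable_realfun.
From mathcomp Require Import ring lra zify.

Set Implicit Arguments.
Unset Strict Implicit.
Unset Printing Implicit Defensive.

Import Order.TTheory GRing.Theory Num.Theory.
Import numFieldNormedType.Exports.

Local Open Scope classical_set_scope.
Local Open Scope ring_scope.

(** * Nonnegative functions with a known integral *)

(** The divergence may be infinite and the evidence may vanish, so the integral defining the
    divergence is never split into expectations. Its integrand is bounded below by [K * q - N],
    where [N] is nonnegative and both [q] and [N] have finite integrals, and the two integrals are
    compared once. All three moments enter through [N], hence with a minus sign: upper bounds on
    them suffice, and the logarithmic and quadratic moments are indeed obtained only as
    inequalities. The evidence is replaced by a free positive guess [z]. Choosing [z] equal to a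
    positive evidence gives the bound, while for zero evidence a suitable [z] contradicts a finite
    divergence. Gaussian and Dirichlet normalizations are both proved by peeling off the first
    coordinate. What remains is an integral of the same family, with the Schur complement as its
    matrix in one case and the remaining mass as its scale in the other. *)

Section nonnegative_integrals.
Local Open Scope ereal_scope.
Context (R : realType).

(* Everything is reduced to integrals of nonnegative functions with a finite
   real value, so that no integrability side condition has to be tracked. *)
Definition nnint d (T : measurableType d) (mu : {measure set T -> \bar R})
    (f : T -> R) (c : R) : Prop :=
  [/\ measurable_fun [set: T] f, forall x, (0 <= f x)%R &
      \int[mu]_x (f x)%:E = c%:E].

Lemma nnint_ge0 d (T : measurableType d) (mu : {measure set T -> \bar R}) f c :
  nnint mu f c -> (0 <= c)%R.
Proof.
move=> [_ f0 fc]; rewrite -lee_fin -fc; apply: integral_ge0 => x _.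
by rewrite lee_fin.
Qed.

Lemma nnint_integrable d (T : measurableType d)
    (mu : {measure set T -> \bar R}) f c :
  nnint mu f c -> mu.-integrable setT (EFin \o f).
Proof.
move=> [mf f0 fc]; apply/integrableP; split; first exact/measurable_EFinP.
under eq_integral do rewrite /= ger0_norm//.
by rewrite fc ltry.
Qed.

Lemma nnintZ d (T : measurableType d) (mu : {measure set T -> \bar R}) f c k :
  (0 <= k)%R -> nnint mu f c -> nnint mu (fun x => k * f x)%R (k * c)%R.
Proof.
move=> k0 [mf f0 fc]; split; first exact: measurable_funM.
- by move=> x; rewrite mulr_ge0.
- under eq_integral do rewrite EFinM.
  rewrite ge0_integralZl_EFin ?fc//; first by move=> x _; rewrite lee_fin.
  exact/measurable_EFinP.
Qed.

(** The value for [f] stays existential because in the applications only an upper bound on it is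
    known. *)
Lemma nnint_le d (T : measurableType d) (mu : {measure set T -> \bar R})
    (f g : T -> R) c :
  measurable_fun [set: T] f -> (forall x, 0 <= f x <= g x)%R ->
  nnint mu g c -> exists2 b, nnint mu f b & (b <= c)%R.
Proof.
move=> mf fg [mg g0 gc].
have fle : \int[mu]_x (f x)%:E <= c%:E.
  rewrite -gc; apply: ge0_le_integral => //.
  - by move=> x _; rewrite lee_fin; case/andP: (fg x).
  - exact/measurable_EFinP.
  - exact/measurable_EFinP.
  - by move=> x _; rewrite lee_fin; case/andP: (fg x).
have ffin : \int[mu]_x (f x)%:E \is a fin_num.
  rewrite ge0_fin_numE ?(le_lt_trans fle) ?ltry//.
  by apply: integral_ge0 => x _; rewrite lee_fin; case/andP: (fg x).
exists (fine (\int[mu]_x (f x)%:E)); last by rewrite -lee_fin fineK.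
by split => [//|x|]; [case/andP: (fg x)|rewrite fineK].
Qed.

Lemma eq_nnint d (T : measurableType d) (mu : {measure set T -> \bar R})
    (f g : T -> R) b c : f =1 g -> b = c -> nnint mu f b -> nnint mu g c.
Proof. by move=> /funext -> ->. Qed.

Lemma nnintD d (T : measurableType d) (mu : {measure set T -> \bar R})
    (f g : T -> R) b c :
  nnint mu f b -> nnint mu g c -> nnint mu (fun x => f x + g x)%R (b + c)%R.
Proof.
move=> [mf f0 fb] [mg g0 gc]; split.
- exact: measurable_funD.
- by move=> x; rewrite addr_ge0.
- under eq_integral do rewrite EFinD.
  rewrite ge0_integralD ?fb ?gc//.
  + by move=> x _; rewrite lee_fin.
  + exact/measurable_EFinP.
  + by move=> x _; rewrite lee_fin.
  + exact/measurable_EFinP.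
Qed.

Lemma nnintB d (T : measurableType d) (mu : {measure set T -> \bar R})
    (f g : T -> R) b c : (forall x, g x <= f x)%R ->
  nnint mu f b -> nnint mu g c -> nnint mu (fun x => f x - g x)%R (b - c)%R.
Proof.
move=> gf fb gc; have fi := nnint_integrable fb; have gi := nnint_integrable gc.
case: fb gc => [mf f0 fb] [mg g0 gc]; split.
- exact: measurable_funB.
- by move=> x; rewrite subr_ge0.
- by under eq_integral do rewrite EFinB; rewrite integralB_EFin// fb gc.
Qed.

(* Monotone convergence as n grows: second moments are obtained from the
   damped integrals, which are again Gaussian normalization constants. *)
Lemma nnint_damping d (T : measurableType d) (mu : {measure set T -> \bar R})
    (X g : T -> R) K C :
  measurable_fun setT X -> measurable_fun setT g ->
  (forall x, 0 <= X x)%R -> (forall x, 0 <= g x)%R ->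
  (forall n, \int[mu]_x (X x * expR (- (n.+1%:R^-1 * X x)) * g x)%:E
    <= (K + n.+1%:R^-1 * C)%:E) ->
  exists2 b, nnint mu (fun x => X x * g x)%R b & (b <= K)%R.
Proof.
move=> mX mg X0 g0 H.
pose h n x := (X x * expR (- (n.+1%:R^-1 * X x)) * g x)%:E.
have mh n : measurable_fun setT (h n).
  apply/measurable_EFinP; apply: measurable_funM => //.
  apply: measurable_funM => //; apply: measurableT_comp => //.
  by apply: measurableT_comp => //; exact: measurable_funM.
have h0 n x : setT x -> 0 <= h n x.
  by move=> _; rewrite lee_fin !mulr_ge0// expR_ge0.
have ndh x : setT x -> nondecreasing_seq (h ^~ x).
  move=> _ m n mn; rewrite lee_fin ler_wpM2r// ler_wpM2l// ler_expR lerN2.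
  by rewrite ler_wpM2r// lef_pV2 ?posrE// ler_nat.
have cvgV : (n.+1%:R^-1 : R)%R @[n --> \oo] --> (0 : R)%R.
  exact: (@cvg_harmonic R).
have hX x : h n x @[n --> \oo] --> (X x * g x)%:E.
  apply: cvg_EFin; first exact: nearW.
  have : (X x * expR (- (n.+1%:R^-1 * X x)) * g x)%R @[n --> \oo] -->
      (X x * expR (- (0 * X x)) * g x)%R.
    apply: cvgM; last exact: cvg_cst.
    apply: cvgM; first exact: cvg_cst.
    apply: continuous_cvg; first exact: continuous_expR.
    by apply: cvgN; apply: cvgM => //; exact: cvg_cst.
  by rewrite mul0r oppr0 expR0 mulr1.
have intX : \int[mu]_x (X x * g x)%:E = \int[mu]_x limn (h ^~ x).
  by apply: eq_integral => x _; apply/esym/cvg_lim.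
have cvgI : \int[mu]_x h n x @[n --> \oo] --> \int[mu]_x (X x * g x)%:E.
  by rewrite intX; apply: cvg_monotone_convergence.
have cvgK : (K + n.+1%:R^-1 * C)%:E @[n --> \oo] --> K%:E.
  apply: cvg_EFin; first exact: nearW.
  rewrite -[in Y in _ --> Y](addr0 K) -(mul0r C); apply: cvgD; first exact: cvg_cst.
  by apply: cvgM => //; exact: cvg_cst.
have intK : \int[mu]_x (X x * g x)%:E <= K%:E.
  rewrite -(cvg_lim _ cvgI)// -(cvg_lim _ cvgK)//; apply: lee_lim.
  - by apply/cvg_ex; eexists; exact: cvgI.
  - by apply/cvg_ex; eexists; exact: cvgK.
  - exact: nearW.
have int0 : 0 <= \int[mu]_x (X x * g x)%:E.
  by apply: integral_ge0 => x _; rewrite lee_fin mulr_ge0.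
exists (fine (\int[mu]_x (X x * g x)%:E)).
  split; [exact: measurable_funM|by move=> x; rewrite mulr_ge0|].
  by rewrite fineK// ge0_fin_numE// (le_lt_trans intK)// ltry.
by rewrite -lee_fin fineK// ge0_fin_numE// (le_lt_trans intK)// ltry.
Qed.

Section products.
Context d1 d2 (T1 : measurableType d1) (T2 : measurableType d2).
Variables (m1 : {sigma_finite_measure set T1 -> \bar R})
  (m2 : {sigma_finite_measure set T2 -> \bar R}).

Lemma nnint_prod f g a b : nnint m1 f a -> nnint m2 g b ->
  nnint (m1 \x m2) (fun x => f x.1 * g x.2)%R (a * b)%R.
Proof.
move=> [mf f0 fa] [mg g0 gb].
have m_fg : measurable_fun setT (fun x : T1 * T2 => f x.1 * g x.2)%R.
  apply: measurable_funM; first exact: (measurableT_comp mf).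
  exact: (measurableT_comp mg).
split => [//|x|]; first by rewrite mulr_ge0.
rewrite (fubini_tonelli1 (fun x => (f x.1 * g x.2)%:E)) /=; first last.
- by move=> x; rewrite lee_fin mulr_ge0.
- exact/measurable_EFinP.
rewrite /fubini_F /=.
under eq_integral => x _.
  under eq_integral do rewrite EFinM.
  rewrite ge0_integralZl_EFin ?gb//; last 2 first.
  - by move=> y _; rewrite lee_fin.
  - exact/measurable_EFinP.
  over.
rewrite ge0_integralZr ?fa//; first exact/measurable_EFinP.
- by move=> x _; rewrite lee_fin.
- by rewrite lee_fin (nnint_ge0 (And3 mg g0 gb)).
Qed.

End products.

Section tuples.
Context d (T : measurableType d) (m : {sigma_finite_measure set T -> \bar R}).

Lemma ge0_integral_tuple_measureS n (f : n.+1.-tuple T -> \bar R) :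
  measurable_fun setT f -> (forall v, 0 <= f v) ->
  \int[tuple_measure m n.+1]_v f v =
  \int[m \x tuple_measure m n]_x f (tuple_cons x).
Proof.
move=> mf f0.
by rewrite (ge0_integral_pushforward (@measurable_tuple_cons _ T n)).
Qed.

Lemma integral_tuple_measure0 (f : 0.-tuple T -> \bar R) :
  measurable_fun setT f -> \int[tuple_measure m 0]_v f v = f [tuple].
Proof. by move=> mf; rewrite integral_dirac// diracT mul1e. Qed.

Lemma nnint_tuple n (g : 'I_n -> T -> R) (c : 'I_n -> R) :
  (forall k, nnint m (g k) (c k)) ->
  nnint (tuple_measure m n) (fun v => \prod_k g k (tnth v k))%R (\prod_k c k)%R.
Proof.
move=> gc.
have mprod : measurable_fun setT (fun v : n.-tuple T => \prod_k g k (tnth v k))%R.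
  apply: measurable_prod => k _; have [mg _ _] := gc k.
  exact: (measurableT_comp mg (measurable_tnth _)).
have prod0 (v : n.-tuple T) : (0 <= \prod_k g k (tnth v k))%R.
  by apply: prodr_ge0 => k _; have [_ + _] := gc k; exact.
split => //; elim: n => [|n IH] in g c gc mprod prod0 *.
  rewrite integral_tuple_measure0 ?big_ord0//; exact/measurable_EFinP.
rewrite ge0_integral_tuple_measureS; first last.
- by move=> v; rewrite lee_fin.
- exact/measurable_EFinP.
have gc' k : nnint m (g (lift ord0 k)) (c (lift ord0 k)) by exact: gc.
have mprod' : measurable_fun setT
    (fun v : n.-tuple T => \prod_k g (lift ord0 k) (tnth v k))%R.
  apply: measurable_prod => k _; have [mg _ _] := gc' k.
  exact: (measurableT_comp mg (measurable_tnth _)).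
have prod0' (v : n.-tuple T) : (0 <= \prod_k g (lift ord0 k) (tnth v k))%R.
  by apply: prodr_ge0 => k _; have [_ + _] := gc' k; exact.
have := nnint_prod (gc ord0) (And3 mprod' prod0' (IH _ _ gc' mprod' prod0')).
rewrite big_ord_recl => -[_ _ <-]; apply: eq_integral => x _.
rewrite big_ord_recl; congr (_ * _)%:E; apply: eq_bigr => k _.
by rewrite (tnthS x.1).
Qed.

End tuples.
End nonnegative_integrals.

(** * Gaussian integrals *)
Section quadratic_forms.
Context (R : realType).

Definition qform n (P : 'M[R]_n) (w : 'cV[R]_n) : R := (w^T *m P *m w) 0 0.

Lemma qformE n (P : 'M[R]_n) w :
  qform P w = \sum_i \sum_j w i 0 * P i j * w j 0.
Proof.
rewrite /qform mxE exchange_big; apply: eq_bigr => j _.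
by rewrite !mxE mulr_suml; apply: eq_bigr => i _; rewrite !mxE.
Qed.

Lemma qformD n (P Q : 'M[R]_n) w : qform (P + Q) w = qform P w + qform Q w.
Proof. by rewrite /qform mulmxDr mulmxDl mxE. Qed.

Lemma qformZ n k (P : 'M[R]_n) w : qform (k *: P) w = k * qform P w.
Proof. by rewrite /qform -scalemxAr -scalemxAl mxE. Qed.

Lemma posdef_qform_ge0 n (P : 'M[R]_n) w : sym_posdef P -> 0 <= qform P w.
Proof.
move=> [_ pP]; have [->|/pP/ltW//] := eqVneq w 0.
by rewrite /qform mulmx0 mxE.
Qed.

Lemma sym_posdefD n (P Q : 'M[R]_n) :
  sym_posdef P -> sym_posdef Q -> sym_posdef (P + Q).
Proof.
move=> [sP pP] [sQ pQ]; split; first by rewrite linearD /= sP sQ.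
by move=> w w0; rewrite -/(qform _ _) qformD addr_gt0 ?pP ?pQ.
Qed.

Lemma sym_posdefZ n k (P : 'M[R]_n) :
  0 < k -> sym_posdef P -> sym_posdef (k *: P).
Proof.
move=> k0 [sP pP]; split; first by rewrite linearZ /= sP.
by move=> w w0; rewrite -/(qform _ _) qformZ mulr_gt0 ?pP.
Qed.

Lemma posdef_unitmx n (P : 'M[R]_n) : sym_posdef P -> P \in unitmx.
Proof.
move=> [_ pP]; rewrite -row_free_unit -kermx_eq0.
apply/negPn/negP => /rowV0Pn[v /sub_kermxP vP v0].
have /pP : v^T != 0 by rewrite -[0]trmx0 (inj_eq trmx_inj).
by rewrite trmxK vP mul0mx mxE ltxx.
Qed.

Lemma sym_posdefV n (P : 'M[R]_n) : sym_posdef P -> sym_posdef (invmx P).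
Proof.
move=> sP; have uP := posdef_unitmx sP; case: sP => sP pP.
have sV : (invmx P)^T = invmx P by rewrite trmx_inv sP.
split => // w w0.
have /pP : invmx P *m w != 0.
  apply: contra_neq w0 => Pw0.
  by rewrite -[w](mulKVmx uP) Pw0 mulmx0.
by rewrite trmx_mul sV -mulmxA (mulKVmx uP).
Qed.

(* Completing the square in the first variable leaves the Schur complement as
   the form in the remaining ones. *)
Section schur.
Variables (n : nat) (P : 'M[R]_(1 + n)).
Let a := ulsubmx P 0 0.
Let b := dlsubmx P.

Definition schur : 'M[R]_n := drsubmx P - a^-1 *: (b *m b^T).

Lemma schur_blockE : sym_posdef P -> P = block_mx a%:M b^T b (drsubmx P).
Proof.
move=> [sP _]; rewrite -[LHS]submxK; congr block_mx.
- by rewrite [LHS]mx11_scalar.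
- by rewrite /b trmx_dlsub sP.
Qed.

Lemma posdef_pivot_gt0 : sym_posdef P -> 0 < a.
Proof.
move=> sP; have PE := schur_blockE sP; case: sP => _ /(_ (col_mx 1%:M 0)).
have -> : col_mx 1%:M 0 != 0 :> 'cV[R]_(1 + n).
  apply/eqP => /(congr1 usubmx); rewrite col_mxKu => /matrixP/(_ 0 0).
  by rewrite !mxE => /eqP; rewrite oner_eq0.
move=> /(_ isT); rewrite {1}PE tr_col_mx mul_row_block mul_row_col.
by rewrite !trmx1 !trmx0 !mulmx0 addr0 mul1mx mul0mx addr0 mulmx1 mxE.
Qed.

Lemma qform_schur x w : sym_posdef P ->
  qform P (col_mx x%:M w) = a * (x + (b^T *m w) 0 0 / a) ^+ 2 + qform schur w.
Proof.
move=> sP; have a0 := posdef_pivot_gt0 sP.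
rewrite /qform {1}(schur_blockE sP) tr_col_mx mul_row_block mul_row_col.
rewrite tr_scalar_mx /schur mulmxBr mulmxBl -scalemxAr -scalemxAl mulmxDl.
have -> : w^T *m (b *m b^T) *m w = (b^T *m w)^T *m (b^T *m w).
  by rewrite trmx_mul trmxK !mulmxA.
have -> : w^T *m b = (b^T *m w)^T by rewrite trmx_mul trmxK.
rewrite mulmxDl -[_ *m b^T *m w]mulmxA; move: (b^T *m w) => c.
rewrite [c]mx11_scalar tr_scalar_mx -!scalar_mxM scale_scalar_mx.
move: (w^T *m _ *m w) => d; rewrite !mxE /= !mulr1n.
by field; rewrite gt_eqF.
Qed.

Lemma posdef_schur : sym_posdef P -> sym_posdef schur.
Proof.
move=> sP; have a0 := posdef_pivot_gt0 sP; split.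
  rewrite /schur linearB /= linearZ /= trmx_mul trmxK; congr (_ - _).
  by rewrite trmx_drsub; case: sP => ->.
(* This first coordinate makes the completed square vanish, so that [P] takes there the value of
   [schur P] at [w]. *)
move=> w w0; case: (sP) => _ /(_ (col_mx (- ((b^T *m w) 0 0 / a))%:M w)).
have -> : col_mx (- ((b^T *m w) 0 0 / a))%:M w != 0.
  by apply: contra_neq w0 => /(congr1 dsubmx); rewrite col_mxKd linear0.
by move=> /(_ isT); rewrite -/(qform _ _) qform_schur// addNr expr0n mulr0 add0r.
Qed.

Lemma det_schur : sym_posdef P -> \det P = a * \det schur.
Proof.
move=> sP; have a0 := posdef_pivot_gt0 sP.
have -> : P = block_mx 1%:M 0 (a^-1 *: b) 1%:M *m block_mx a%:M b^T 0 schur.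
  rewrite {1}(schur_blockE sP) mulmx_block !mul1mx !mul0mx !addr0 -!scalemxAl.
  rewrite mul_mx_scalar scalerA mulVf ?gt_eqF// scale1r.
  by rewrite /schur addrC subrK.
by rewrite det_mulmx det_lblock det_ublock !det1 det_scalar1 !mul1r.
Qed.

End schur.

Lemma posdef_det_gt0 n (P : 'M[R]_n) : sym_posdef P -> 0 < \det P.
Proof.
elim: n P => [|n IH] P sP; first by rewrite det_mx00.
by rewrite (det_schur sP) mulr_gt0 ?posdef_pivot_gt0// IH//; exact: posdef_schur.
Qed.

End quadratic_forms.

(** * Normalization of multivariate Gaussians *)

Section gaussian_integral.
Context (R : realType).
Local Notation leb := (@lebesgue_measure R).

Lemma vec_of_cons n (x : R) (v : Rvec R n) :
  vec_of (tuple_cons (x, v)) = col_mx x%:M (vec_of v) :> 'cV[R]_(1 + n).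
Proof.
apply/colP => i; rewrite mxE; case: (splitP i) => j ij.
  rewrite (_ : i = lshift n j) ?col_mxEu ?mxE//; last exact/val_inj.
  rewrite !ord1 eqxx mulr1n.
  by rewrite (_ : lshift n 0 = ord0)//; exact/val_inj.
rewrite (_ : i = rshift 1 j) ?col_mxEd ?mxE//; last exact/val_inj.
rewrite (_ : rshift 1 j = lift ord0 j) ?(tnthS x)//; exact/val_inj.
Qed.

Lemma subr_col_mx n x (v : 'cV[R]_n) (c : 'cV[R]_(1 + n)) :
  col_mx x%:M v - c = col_mx (x - usubmx c 0 0)%:M (v - dsubmx c).
Proof.
rewrite -{1}[c]vsubmxK opp_col_mx add_col_mx; congr col_mx.
by apply/matrixP => i j; rewrite !ord1 !mxE !eqxx !mulr1n.
Qed.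

Lemma measurable_qform d (T : measurableType d) n (P : 'M[R]_n)
    (w : T -> 'cV[R]_n) :
  (forall i, measurable_fun setT (fun x => w x i 0)) ->
  measurable_fun setT (fun x => qform P (w x)).
Proof.
move=> mw; under eq_fun do rewrite qformE.
apply: measurable_sum => i; apply: measurable_sum => j.
by do 2 apply: measurable_funM => //.
Qed.

Lemma measurable_qform_vec_of n (P : 'M[R]_n) (c : 'cV[R]_n) :
  measurable_fun setT (fun v : Rvec R n => qform P (vec_of v - c)).
Proof.
apply: measurable_qform => i; under eq_fun do rewrite !mxE.
by apply: measurable_funB => //; exact: measurable_tnth.
Qed.

Lemma nnint_gauss1 (a m : R) : 0 < a ->
  nnint leb (fun x : measurableTypeR R => expR (- (a * (x - m) ^+ 2) / 2))
    (Num.sqrt (2 * pi / a)).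
Proof.
(* [a] is a precision, whereas [normal_pdf] expects a standard deviation. *)
move=> a0; pose s := Num.sqrt a^-1.
have s0 : s != 0 by rewrite gt_eqF// sqrtr_gt0 invr_gt0.
have s2 : s ^+ 2 = a^-1 by rewrite sqr_sqrtr// invr_ge0 ltW.
have fE x : expR (- (a * (x - m) ^+ 2) / 2) =
    Num.sqrt (2 * pi / a) * normal_pdf m s x.
  rewrite normal_pdfE// /normal_peak /normal_fun s2.
  rewrite (_ : a^-1 * pi *+ 2 = 2 * pi / a); last by ring.
  rewrite mulVKf; last first.
    by rewrite gt_eqF// sqrtr_gt0 !mulr_gt0 ?pi_gt0// invr_gt0.
  by congr expR; rewrite -mulr_natr; field; rewrite gt_eqF.
split.
- under eq_fun do rewrite fE; apply: measurable_funM => //.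
  exact: measurable_normal_pdf.
- by move=> x; exact: expR_ge0.
- under eq_integral do rewrite fE EFinM.
  rewrite ge0_integralZl_EFin ?integral_normal_pdf ?mule1//.
  + by move=> x _; rewrite lee_fin normal_pdf_ge0.
  + apply/measurable_EFinP; exact: measurable_normal_pdf.
Qed.

(** Here [P] is a precision matrix, hence the determinant in the denominator. Integrating out the
    first coordinate produces a one-dimensional constant governed by the pivot and leaves the form
    of the Schur complement; [det_schur] reassembles the determinant. *)
Lemma nnint_gauss n (P : 'M[R]_n) (c : 'cV[R]_n) : sym_posdef P ->
  nnint (lebesgue_vec R n) (fun v => expR (- qform P (vec_of v - c) / 2))
    (Num.sqrt ((2 * pi) ^+ n / \det P)).
Proof.
have mg n' (P' : 'M[R]_n') (c' : 'cV[R]_n') : measurable_fun setT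
    (fun v : Rvec R n' => expR (- qform P' (vec_of v - c') / 2)).
  apply: measurableT_comp => //; apply: measurable_funM => //.
  by apply: measurableT_comp => //; exact: measurable_qform_vec_of.
move=> sP; split; [exact: mg|by move=> v; exact: expR_ge0|].
elim: n => [|n IH] in P c sP *.
  rewrite /lebesgue_vec integral_tuple_measure0; last first.
    by apply/measurable_EFinP; exact: mg.
  rewrite expr0 det_mx00 divr1 sqrtr1 qformE big_ord0.
  by rewrite oppr0 mul0r expR0.
rewrite /lebesgue_vec ge0_integral_tuple_measureS; last 2 first.
- by apply/measurable_EFinP; exact: mg.
- by move=> v; rewrite lee_fin expR_ge0.
pose a : R := ulsubmx (P : 'M[R]_(1 + n)) 0 0.
have sS := posdef_schur sP; have a0 : 0 < a := posdef_pivot_gt0 sP.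
have msplit : measurable_fun setT (fun z : measurableTypeR R * Rvec R n =>
    (expR (- qform P (vec_of (tuple_cons z) - c) / 2))%:E).
  apply/measurable_EFinP.
  exact: (measurableT_comp (mg _ P c)
    (@measurable_tuple_cons _ (measurableTypeR R) n)).
rewrite (fubini_tonelli2 _ msplit); last first.
  by move=> z; rewrite lee_fin expR_ge0.
rewrite /fubini_G /=.
transitivity (\int[lebesgue_vec R n]_v (Num.sqrt (2 * pi / a) *
    expR (- qform (schur P) (vec_of v - dsubmx (c : 'cV_(1 + n))) / 2))%:E)%E.
  apply: eq_integral => v _.
  pose w := vec_of v - dsubmx (c : 'cV_(1 + n)).
  (* The centre [m] depends on the remaining coordinates, but the value of the one-dimensional
     integral does not depend on [m]. *)
  pose m := usubmx (c : 'cV_(1 + n)) 0 0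
    - ((dlsubmx (P : 'M[R]_(1 + n)))^T *m w) 0 0 / a.
  transitivity (\int[leb]_(x in setT) (
    (expR (- qform (schur P) w / 2) *
     expR (- (a * (x - m) ^+ 2) / 2))%:E))%E.
    apply: eq_integral => x _.
    rewrite vec_of_cons (subr_col_mx x _ c) qform_schur// -expRD; congr (expR _)%:E.
    rewrite -/w /m -/a; field.
    by rewrite gt_eqF.
  rewrite [in RHS]mulrC.
  by case: (nnintZ (expR_ge0 (- qform (schur P) w / 2)) (nnint_gauss1 m a0)).
have [_ _ ->] := nnintZ (sqrtr_ge0 (2 * pi / a))
  (And3 (mg _ _ _) (fun=> expR_ge0 _) (IH _ (dsubmx (c : 'cV_(1 + n))) sS)).
rewrite -sqrtrM; last by rewrite !mulr_ge0 ?pi_ge0// invr_ge0 ltW.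
rewrite (det_schur sP) -/a exprS; congr (Num.sqrt _)%:E.
by field; rewrite (gt_eqF a0) gt_eqF// posdef_det_gt0.
Qed.

End gaussian_integral.

(** * Gaussian convolution and the mean of a quadratic form *)

Section gaussian_moments.
Context (R : realType).

Lemma horner_char_poly n (A : 'M[R]_n) a :
  (char_poly A).[a] = \det (a%:M - A).
Proof.
rewrite /char_poly horner_sum; apply: eq_bigr => s _.
rewrite hornerM horner_exp !hornerE; congr (_ * _).
rewrite (big_morph _ (fun p q => hornerM p q a) (hornerC 1 a)).
by apply: eq_bigr => i _; rewrite !mxE !(hornerE, hornerMn).
Qed.

(** Up to the factor [t ^+ n], for size [n], the determinant is the characteristic polynomial of
    [- M] at [t^-1]. Its two leading coefficients, 1 and the trace, give the affine part; each lower
    coefficient carries at least [t ^+ 2], and [t <= 1] makes [C] uniform. *)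
Lemma det_1DZ_le n (M : 'M[R]_n) :
  exists C, forall t, 0 < t <= 1 ->
    \det (1%:M + t *: M) <= 1 + t * \tr M + t ^+ 2 * C.
Proof.
case: n M => [|n] M.
  by exists 0 => t _; rewrite det_mx00 /mxtrace big_ord0 !mulr0 !addr0.
pose p := char_poly (- M).
exists (\sum_(i < n) `|p`_i|) => t /andP[t0 t1].
have -> : \det (1%:M + t *: M) = t ^+ n.+1 * p.[t^-1].
  rewrite horner_char_poly -detZ opprK; congr (\det _).
  by rewrite scalerDr scale_scalar_mx divff// gt_eqF.
rewrite horner_coef size_char_poly !big_ord_recr /=.
have -> : p`_n = \tr M.
  by rewrite (char_poly_trace (- M))// raddfN opprK.
have -> : p`_n.+1 = 1.
  by have := char_poly_monic (- M); rewrite monicE lead_coefE size_char_poly => /eqP.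
have -> : t ^+ n.+1 * (\sum_(i < n) p`_i * t^-1 ^+ i + \tr M * t^-1 ^+ n +
    1 * t^-1 ^+ n.+1) =
    1 + t * \tr M + t ^+ 2 * \sum_(i < n) p`_i * t ^+ (n.-1 - i).
  rewrite !mulrDr mul1r -exprMn divff ?gt_eqF// expr1n addrC -!addrA; congr (_ + _).
  rewrite addrC; congr (_ + _).
    rewrite !mulr_sumr; apply: eq_bigr => i _.
    rewrite mulrCA [RHS]mulrCA; congr (_ * _).
    have -> : n.+1 = (2 + (n.-1 - i) + i)%N by have := ltn_ord i; lia.
    by rewrite exprD -[LHS]mulrA -exprMn divff ?gt_eqF// expr1n mulr1 exprD.
  rewrite mulrCA exprS -mulrA -exprMn divff ?gt_eqF// expr1n.
  by rewrite mulr1 mulrC.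
rewrite lerD2l ler_wpM2l ?sqr_ge0//; apply: ler_sum => i _.
rewrite (le_trans (ler_norm _))// normrM ler_piMr//.
by rewrite ger0_norm ?exprn_ge0 ?exprn_ile1 ?(ltW t0).
Qed.

Lemma qformB n (A : 'M[R]_n) x y : A^T = A ->
  qform A (x - y) = qform A x + qform A y - 2 * (x^T *m A *m y) 0 0.
Proof.
move=> sA; have yAx : (y^T *m A *m x) = (x^T *m A *m y).
  apply/matrixP => i j; rewrite !ord1.
  have -> : y^T *m A *m x = (x^T *m A *m y)^T.
    by rewrite !trmx_mul trmxK sA mulmxA.
  by rewrite mxE.
rewrite /qform [(x - y)^T]linearB /= !mulmxBl !mulmxBr yAx.
move: (x^T *m A *m y) (x^T *m A *m x) (y^T *m A *m y) => a b c.
by rewrite !mxE; ring.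
Qed.

Section complete_square.
Variables (n : nat) (P Q : 'M[R]_n) (f m : 'cV[R]_n).
Hypotheses (sP : sym_posdef P) (sQ : sym_posdef Q).
Let N := P + Q.
Let d := f - m.
(** Offset from [m] of the precision-weighted mean of [m] and [f], which minimizes the sum of the
    two forms. *)
Let c := invmx N *m Q *m d.

Let sN : sym_posdef N. Proof. exact: sym_posdefD. Qed.

Lemma qform_complete_square v :
  qform Q (f - v) + qform P (v - m) =
  qform N (v - (m + c)) + (qform Q d - qform N c).
Proof.
have -> : f - v = d - (v - m) by rewrite /d opprB addrA subrK.
have -> : v - (m + c) = (v - m) - c by rewrite opprD addrA.
move: (v - m) => w.
have Nc : N *m c = Q *m d by rewrite /c -mulmxA mulKVmx ?posdef_unitmx.
rewrite !qformB ?(proj1 sN) ?(proj1 sQ)//.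
rewrite -[w^T *m N *m c]mulmxA Nc.
have -> : w^T *m (Q *m d) = (d^T *m Q *m w)^T.
  by rewrite !trmx_mul trmxK (proj1 sQ).
rewrite [(d^T *m Q *m w)^T 0 0]mxE; have -> : qform N w = qform P w + qform Q w.
  exact: qformD.
by ring.
Qed.

Lemma nnint_gaussM :
  nnint (lebesgue_vec R n)
    (fun v => expR (- qform Q (f - vec_of v) / 2) *
              expR (- qform P (vec_of v - m) / 2))
    (expR (- (qform Q d - qform N c) / 2) * Num.sqrt ((2 * pi) ^+ n / \det N)).
Proof.
have := nnintZ (expR_ge0 (- (qform Q d - qform N c) / 2)) (nnint_gauss (m + c) sN).
apply: eq_nnint => // v; rewrite -!expRD -2!mulrDl -2!opprD qform_complete_square.
by rewrite addrC.
Qed.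

(** For the damped integrals [Q] is multiplied by a small [t]; the term dropped here is then of
    second order in [t]. *)
Lemma complete_square_le : qform Q d - qform N c <= qform Q d.
Proof. by rewrite gerDl oppr_le0 posdef_qform_ge0. Qed.

(** Covariances add under convolution: both sides are the form of the parallel sum
    [P *m invmx N *m Q], which inverts the sum of the inverses and also equals
    [Q - Q *m invmx N *m Q]. *)
Lemma complete_square_conv :
  qform Q d - qform N c = qform (invmx (invmx P + invmx Q)) d.
Proof.
have uP := posdef_unitmx sP; have uQ := posdef_unitmx sQ.
have uN := posdef_unitmx sN.
have NVE : (invmx P + invmx Q) *m (P *m invmx N *m Q) = 1%:M.
  have -> : invmx P + invmx Q = invmx Q *m N *m invmx P.
    by rewrite mulmxDr mulmxDl mulVmx// mul1mx -mulmxA mulmxV// mulmx1 addrC.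
  by rewrite !mulmxA (mulmxKV uP) (mulmxK uN) mulVmx.
have -> : invmx (invmx P + invmx Q) = P *m invmx N *m Q.
  have [uA _] := mulmx1_unit NVE.
  by rewrite -[LHS]mulmx1 -NVE mulKmx.
have -> : P *m invmx N *m Q = Q - Q *m invmx N *m Q.
  have -> : P = N - Q by rewrite addrK.
  by rewrite !mulmxBl mulmxV// mul1mx.
have cE : c^T *m N *m c = d^T *m (Q *m invmx N *m Q) *m d.
  rewrite /c !trmx_mul trmx_inv (proj1 sN) (proj1 sQ) !mulmxA.
  by rewrite (mulmxKV uN).
by rewrite qformD; congr (_ + _); rewrite /qform cE mulmxN mulNmx [RHS]mxE.
Qed.

End complete_square.

Lemma gauss_normalizer_gt0 n (C : 'M[R]_n) :
  sym_posdef C -> 0 < (2 * pi) ^+ n * \det C.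
Proof.
move=> sC; rewrite mulr_gt0 ?posdef_det_gt0// exprn_gt0// mulr_gt0//.
exact: pi_gt0.
Qed.

Lemma gauss_pdf_gt0 n (m : 'cV[R]_n) (C : 'M[R]_n) v :
  sym_posdef C -> 0 < gauss_pdf m C v.
Proof.
move=> sC; rewrite mulr_gt0 ?expR_gt0// invr_gt0 sqrtr_gt0.
exact: gauss_normalizer_gt0.
Qed.

Lemma sqrt_det_invmx n (C : 'M[R]_n) : sym_posdef C ->
  (Num.sqrt ((2 * pi) ^+ n * \det C))^-1 *
  Num.sqrt ((2 * pi) ^+ n / \det (invmx C)) = 1.
Proof.
move=> sC; rewrite det_inv invrK mulVf// gt_eqF// sqrtr_gt0.
exact: gauss_normalizer_gt0.
Qed.

Lemma nnint_gauss_pdf n (m : 'cV[R]_n) (C : 'M[R]_n) : sym_posdef C ->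
  nnint (lebesgue_vec R n) (fun v => gauss_pdf m C (vec_of v)) 1.
Proof.
move=> sC; have sV := sym_posdefV sC.
have k0 : 0 <= (Num.sqrt ((2 * pi) ^+ n * \det C))^-1 by rewrite invr_ge0.
apply: eq_nnint (nnintZ k0 (nnint_gauss m sV)); last exact: sqrt_det_invmx.
by move=> v.
Qed.

Lemma nnint_gauss_pdf_conv n (m f : 'cV[R]_n) (C D : 'M[R]_n) :
  sym_posdef C -> sym_posdef D ->
  nnint (lebesgue_vec R n)
    (fun v => gauss_pdf (vec_of v) D f * gauss_pdf m C (vec_of v))
    (gauss_pdf m (D + C) f).
Proof.
move=> sC sD; have sP := sym_posdefV sC; have sQ := sym_posdefV sD.
pose k (E : 'M[R]_n) := (Num.sqrt ((2 * pi) ^+ n * \det E))^-1.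
have kk0 : 0 <= k D * k C by rewrite mulr_ge0 ?invr_ge0.
apply: eq_nnint (nnintZ kk0 (nnint_gaussM f m sP sQ)).
  by move=> v; rewrite /gauss_pdf -/(k D) -/(k C) -/(qform _ _) mulrACA.
rewrite complete_square_conv// !invmxK (addrC C D) mulrCA mulrC.
congr (_ * _).
have pi2 : 0 < 2 * pi :> R by rewrite mulr_gt0// pi_gt0.
(* This factorization reconciles the normalizers of the two factors with that of the convolution. *)
have detE : \det (D + C) = \det D * \det (invmx C + invmx D) * \det C.
  rewrite -!det_mulmx; congr (\det _).
  rewrite mulmxDr mulmxDl mulmxV ?posdef_unitmx// mul1mx.
  by rewrite -mulmxA mulVmx ?posdef_unitmx// mulmx1.
have d1 := posdef_det_gt0 sD; have d2 := posdef_det_gt0 sC.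
have d3 := posdef_det_gt0 (sym_posdefD sP sQ).
have p0 : 0 < (2 * pi) ^+ n :> R by rewrite exprn_gt0.
rewrite /k -!sqrtrV ?mulr_ge0 ?(ltW p0) ?(ltW d1) ?(ltW d2)//; last first.
  by rewrite detE !mulr_ge0 ?ltW.
rewrite -!sqrtrM ?mulr_ge0 ?invr_ge0 ?mulr_ge0 ?(ltW p0) ?(ltW d1) ?(ltW d2)//.
congr Num.sqrt; rewrite detE; field.
by rewrite ?gt_eqF.
Qed.

Lemma gauss_pdf_qform_moment n (m f : 'cV[R]_n) (C Q : 'M[R]_n) :
  sym_posdef C -> sym_posdef Q ->
  exists2 b, nnint (lebesgue_vec R n)
    (fun v => qform Q (f - vec_of v) / 2 * gauss_pdf m C (vec_of v)) b &
  b <= (qform Q (f - m) + \tr (Q *m C)) / 2.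
Proof.
move=> sC sQ; have sP := sym_posdefV sC.
have [K HK] := det_1DZ_le (C *m Q).
have [mg g0 _] := nnint_gauss_pdf m sC.
have mX : measurable_fun setT
    (fun v : Rvec R n => qform Q (f - vec_of v) / 2).
  apply: measurable_funM => //; apply: measurable_qform => i.
  under eq_fun do rewrite !mxE.
  by apply: measurable_funB => //; exact: measurable_tnth.
(* [K] bounds the second-order term of the determinant; the halved exponent turns it into
   [K / 2]. *)
apply: (@nnint_damping _ _ _ _ _ _ _ (K / 2)) => //.
- by move=> v; rewrite divr_ge0 ?posdef_qform_ge0.
move=> j; set t := j.+1%:R^-1; have t0 : 0 < t by rewrite invr_gt0 ltr0Sn.
have t1 : t <= 1 by rewrite invf_le1 ?ltr0Sn// ler1n.
have stQ := sym_posdefZ t0 sQ; have sN := sym_posdefD sP stQ.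
pose X (v : Rvec R n) := qform Q (f - vec_of v) / 2.
pose k := (Num.sqrt ((2 * pi) ^+ n * \det C))^-1.
have k0 : 0 <= k by rewrite invr_ge0.
have nnt := nnintZ k0 (nnint_gaussM f m sP stQ).
set E := k * _ in nnt.
have tX v : qform (t *: Q) (f - vec_of v) / 2 = t * X v.
  by rewrite qformZ /X mulrA.
have {}nnt : nnint (lebesgue_vec R n)
    (fun v => expR (- (t * X v)) * gauss_pdf m C (vec_of v)) E.
  apply: eq_nnint nnt => // v.
  by rewrite mulrCA /gauss_pdf -/k -/(qform _ _) mulNr tX.
have X0 v : 0 <= X v by rewrite divr_ge0 ?posdef_qform_ge0.
have ltg v : expR (- (t * X v)) * gauss_pdf m C (vec_of v) <=
    gauss_pdf m C (vec_of v).
  by rewrite ler_piMl// expR_le1 oppr_le0 mulr_ge0// ltW.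
have tV0 : 0 <= t^-1 by rewrite invr_ge0 ltW.
have nnB := nnintZ tV0 (nnintB ltg (nnint_gauss_pdf m sC) nnt).
apply: (@le_trans _ _ (t^-1 * (1 - E))%:E).
  have [mB _ <-] := nnB; apply: ge0_le_integral => //.
  - by move=> v _; exact: (mulr_ge0 (mulr_ge0 (X0 v) (expR_ge0 _))).
  - have [mt _ _] := nnt; apply/measurable_EFinP.
    under eq_fun do rewrite -mulrA.
    exact: measurable_funM.
  - exact/measurable_EFinP.
  - move=> v _; rewrite lee_fin -/(X v).
    have H : X v * expR (- (t * X v)) <= t^-1 * (1 - expR (- (t * X v))).
      rewrite ler_pdivlMl// mulrA lerBrDl -[X in X + _]mul1r -mulrDl.
      by rewrite expRN ler_pdivrMr ?expR_gt0// mul1r expR_ge1Dx.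
    by rewrite (le_trans (ler_wpM2r (g0 v) H))// -mulrA mulrBl mul1r.
(* Writing [E] as an exponential, [1 + u <= expR u] bounds [1 - E] by half the sum of the
   completed-square remainder and [ln D]. The latter is at most [D - 1], to which the determinant
   expansion applies. *)
rewrite lee_fin ler_pdivrMl// lerBlDr -lerBlDl.
pose D := \det (1%:M + t *: (C *m Q)).
have DE : D = \det C * \det (invmx C + t *: Q).
  rewrite -det_mulmx; congr (\det _).
  by rewrite mulmxDr mulmxV ?posdef_unitmx// scalemxAr.
have D0 : 0 < D by rewrite DE mulr_gt0 ?posdef_det_gt0.
have p0 : 0 < (2 * pi) ^+ n :> R by rewrite exprn_gt0// mulr_gt0// pi_gt0.
have kE : k * Num.sqrt ((2 * pi) ^+ n / \det (invmx C + t *: Q)) =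
    expR (- (ln D / 2)).
  rewrite expRN (_ : expR (ln D / 2) = Num.sqrt D); last first.
    by rewrite -powR12_sqrt ?ltW// /powR gt_eqF// mulrC.
  rewrite /k -!sqrtrV ?mulr_ge0 ?(ltW p0) ?(ltW D0) ?ltW ?posdef_det_gt0//.
  rewrite -sqrtrM ?invr_ge0 ?mulr_ge0 ?(ltW p0) ?ltW ?posdef_det_gt0//.
  congr Num.sqrt; rewrite DE; field.
  by rewrite !gt_eqF ?posdef_det_gt0.
rewrite /E [k * _]mulrCA kE -expRD.
rewrite (le_trans _ (expR_ge1Dx _))//.
have AQ := complete_square_le f m sP stQ; rewrite [leRHS]qformZ in AQ.
have lnD : ln D <= t * \tr (C *m Q) + t ^+ 2 * K.
  rewrite -[D in ln D](subrK 1) addrC (le_trans (le_ln1Dx _))//.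
    by rewrite ltrBrDl subrr.
  by rewrite lerBlDl addrA HK// t0.
rewrite mxtrace_mulC in lnD.
move: AQ lnD; rewrite -lerBlDl; lra.
Qed.

End gaussian_moments.

(** * The Gamma function *)
Section affine_substitution.
Local Open Scope ereal_scope.
Context (R : realType).
Local Notation leb := (@lebesgue_measure R).

(** The pushforward of Lebesgue measure under the affine map, scaled by [a], agrees with Lebesgue
    measure on half-open intervals, hence everywhere by uniqueness. *)
Lemma ge0_integral_affine (a b : R) (f : R -> \bar R) : (0 < a)%R ->
  measurable_fun [set: measurableTypeR R] f -> (forall x, 0 <= f x) ->
  \int[leb]_x f x = a%:E * \int[leb]_x f (a * x + b)%R.
Proof.
move=> a0 mf f0.
pose phi (x : measurableTypeR R) : measurableTypeR R := (a * x + b)%R.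
have mphi : measurable_fun setT phi.
  by apply: measurable_funD => //; exact: measurable_funM.
have pre p q : phi @^-1` `]p, q]%classic =
    `]((p - b) / a)%R, ((q - b) / a)%R]%classic.
  apply/seteqP; split => x; rewrite /phi /= !in_itv/=.
    by rewrite ltr_pdivrMr// ler_pdivlMr// ltrBlDr lerBrDr mulrC.
  by rewrite ltr_pdivrMr// ler_pdivlMr// ltrBlDr lerBrDr mulrC.
pose nu0 := mscale (NngNum (ltW a0)) (pushforward leb phi).
pose nu := nu0 mphi.
have nuE A : measurable A -> leb A = nu A.
  apply: lebesgue_measure_unique => _ [[p q] _ <-].
  transitivity (a%:E * leb (phi @^-1` `]p, q]%classic)); last by [].
  rewrite pre !lebesgue_measure_itv/=.
  rewrite !lte_fin ltr_pM2r ?invr_gt0// ltrD2r.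
  case: ifP => // _; last by rewrite mule0.
  by rewrite -!EFinD -EFinM -mulrBl mulrC divfK ?gt_eqF// opprB addrA subrK.
transitivity (\int[nu]_x f x).
  by apply: eq_measure_integral => A mA _; exact: nuE.
rewrite ge0_integral_mscale//; congr (_ * _).
by rewrite ge0_integral_pushforward// preimage_setT.
Qed.

End affine_substitution.

Section gamma_function.
Context (R : realType).
Local Notation leb := (@lebesgue_measure R).

(* The truncation matters: the library's x `^ e is 1 for x < 0. *)
Definition ppow (x e : R) : R := if 0 < x then x `^ e else 0.

Lemma ppowE x e : 0 < x -> ppow x e = x `^ e.
Proof. by rewrite /ppow => ->. Qed.

Lemma ppow_le0 x e : x <= 0 -> ppow x e = 0.
Proof. by rewrite /ppow ltNge => ->. Qed.

Lemma ppow_ge0 x e : 0 <= ppow x e.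
Proof. by rewrite /ppow; case: ifP => // _; rewrite powR_ge0. Qed.

Lemma measurable_ppow e : measurable_fun setT (ppow ^~ e).
Proof.
apply: measurable_fun_ifT; [|exact: measurable_powR|exact: measurable_cst].
exact: measurable_fun_ltr.
Qed.

Lemma ppowM x y e : 0 < x -> ppow (x * y) e = x `^ e * ppow y e.
Proof.
move=> x0; rewrite /ppow pmulr_rgt0//; case: ltP => [y0|y0].
  by rewrite powRM// ltW.
by rewrite mulr0.
Qed.

(** Extending the integrand by zero to the whole line lets translations and exchanges of integrals
    proceed without tracking domains. *)
Definition gamma_fun (a x : R) : R := ppow x (a - 1) * expR (- x).

Lemma gamma_fun_ge0 a x : 0 <= gamma_fun a x.
Proof. by rewrite mulr_ge0 ?ppow_ge0// expR_ge0. Qed.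

Lemma measurable_gamma_fun a : measurable_fun setT (gamma_fun a).
Proof.
apply: measurable_funM; first exact: measurable_ppow.
by apply: measurableT_comp => //; exact: measurableT_comp.
Qed.

Lemma gamma_funE a : gamma_fun a =
  (fun t => t `^ (a - 1) * expR (- t)) \_ `]0, +oo[.
Proof.
apply/funext => x; rewrite patchE; case: ifPn => [|].
  by rewrite inE/= in_itv/= andbT => x0; rewrite /gamma_fun ppowE.
rewrite notin_setE/= in_itv/= andbT => /negP; rewrite -leNgt => x0.
by rewrite /gamma_fun ppow_le0// mul0r.
Qed.

Lemma GammaE a : Gamma a = (\int[leb]_x gamma_fun a x)%R.
Proof. by rewrite gamma_funE -Rintegral_mkcond. Qed.

(** For [a < 1] the integrand is unbounded near 0, so the fundamental theorem of calculus is applied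
    on the intervals from [n.+1%:R^-1] to 1, which exhaust the domain. *)
Lemma integral_powR01 (a : R) : 0 < a ->
  (\int[leb]_(x in `]0%R, 1%R]) (x `^ (a - 1))%:E = a^-1%:E)%E.
Proof.
move=> a0; pose F (n : nat) : set R := `[n.+1%:R^-1, 1]%classic.
have UF : \bigcup_n F n = `]0, 1]%classic.
  apply/seteqP; split => x /=.
    move=> [n _]; rewrite /F /= !in_itv/= => /andP[nx ->]; rewrite andbT.
    by rewrite (lt_le_trans _ nx)// invr_gt0 ltr0Sn.
  rewrite in_itv/= => /andP[x0 x1]; exists (Num.trunc x^-1) => //.
  rewrite /F/= in_itv/= x1 andbT -[leRHS]invrK lef_pV2 ?posrE ?invr_gt0 ?ltr0Sn//.
  by rewrite ltW// truncnS_gt.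
have mF n : measurable (F n) by exact: measurable_itv.
have mf n : measurable_fun (F n) (fun x : R => (x `^ (a - 1))%:E).
  by apply/measurable_EFinP; apply: measurable_funTS; exact: measurable_powR.
have ndF : nondecreasing_seq F.
  move=> m n mn; apply/subsetPset; apply: subset_itvr.
  by rewrite bnd_simp lef_pV2 ?posrE ?ltr0Sn// ler_nat.
have f0 n (x : R) : F n x -> (0 <= (x `^ (a - 1))%:E)%E.
  by rewrite lee_fin powR_ge0.
have := ge0_nondecreasing_set_cvg_integral ndF mF mf f0 (mu := leb).
rewrite UF => cv; rewrite -(cvg_lim _ cv)//; apply/cvg_lim => //.
have cvF : (a^-1 - a^-1 * (n.+1%:R^-1) `^ a)%:E @[n --> \oo] --> a^-1%:E.
  apply: cvg_EFin; first exact: nearW.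
  rewrite -[X in _ --> X]subr0 -[X in _ --> _ - X](mulr0 a^-1).
  apply: cvgB; first exact: cvg_cst.
  apply: cvgM; first exact: cvg_cst.
  have /cvg_at_rightP := powR_cvg0 a0; apply; split.
    by move=> n; rewrite invr_gt0 ltr0Sn.
  exact: (@cvg_harmonic R).
apply: cvg_trans cvF; apply: near_eq_cvg; apply: nearW => n; rewrite /F.
(* For [n = 0] the interval degenerates to a point. *)
have [n1|n1] := leP 1 (n.+1%:R^-1 : R).
  rewrite (_ : n = 0%N); last first.
    by move: n1; rewrite invf_ge1 ?ltr0Sn// lern1 ltnS leqn0 => /eqP.
  by rewrite invr1 set_itv1 integral_set1 powR1 mulr1 subrr.
have d0 (x : R) : 0 < x -> derivable (fun y : R => y `^ a) x 1.
  by move=> x0; apply: derivable_powR; rewrite in_itv/= andbT.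
have c0 e (x : R) : 0 < x -> {for x, continuous (fun y : R => y `^ e)}.
  move=> x0; have xI : x \in `]0, +oo[ by rewrite in_itv/= andbT.
  apply: differentiable_continuous; apply/derivable1_diffP.
  exact: derivable_powR.
have e0 : 0 < n.+1%:R^-1 :> R by rewrite invr_gt0 ltr0Sn.
rewrite (@continuous_FTC2 _ _ (fun x => a^-1 * x `^ a))//.
- by rewrite -EFinB powR1 mulr1.
- apply: derivable_within_continuous => x; rewrite in_itv/= => /andP[nx _].
  by apply: derivable_powR; rewrite in_itv/= andbT (lt_le_trans e0 nx).
- have cF (x : R) : 0 < x -> {for x, continuous (fun x => a^-1 * x `^ a)}.
    move=> x0; apply: cvgM; first exact: cvg_cst.
    exact: c0.
  split.
  + move=> x; rewrite in_itv/= => /andP[nx _].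
    by apply: derivableM => //; apply: d0; rewrite (lt_trans e0 nx).
  + by apply: cvg_at_right_filter; exact: cF.
  + by apply: cvg_at_left_filter; exact: cF.
- move=> x; rewrite in_itv/= => /andP[nx _]; have x0 := lt_trans e0 nx.
  have [_] := is_derive1_powR a x0.
  rewrite derive1E (_ : (fun x => _) = a^-1 *: (fun y : R => y `^ a))//.
  rewrite deriveZ; last exact: d0.
  by move=> ->; rewrite /GRing.scale/= mulKf// gt_eqF.
Qed.

Lemma gamma_fun_dominated (a : R) : exists2 C, 0 <= C & forall x,
  gamma_fun a x <=
  ((fun x => x `^ (a - 1)) \_ `]0%R, 1%R]) x + C * exponential_pdf 2^-1 x.
Proof.
pose b := `|a - 1|; have b0 : 0 <= b by exact: normr_ge0.
(* With this [e], the bound [ln x <= e * x - ln e] yields [b * ln x <= x / 2 - b * ln e], so the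
   power uses up only half of the exponential decay. The [+ 1] keeps [e] positive when [a = 1], and
   the factor 2 in the constant below cancels the rate in [exponential_pdf]. *)
pose e := (2 * (b + 1))^-1.
have e0 : 0 < e by rewrite invr_gt0 mulr_gt0// ltr_wpDl.
have be : b * e <= 2^-1.
  by rewrite /e invfM mulrCA ler_piMr// ler_pdivrMr ?ltr_wpDl// mul1r lerDl.
exists (2 * expR (b * - ln e)); first by rewrite mulr_ge0 ?expR_ge0.
have E0 x : 0 <= 2 * expR (b * - ln e) * exponential_pdf 2^-1 x.
  by rewrite mulr_ge0 ?mulr_ge0 ?expR_ge0 ?exponential_pdf_ge0.
move=> x; have [x0|x0] := leP x 0.
  rewrite {1}/gamma_fun ppow_le0// mul0r addr_ge0//.
  by rewrite patchE; case: ifP => // _; rewrite powR_ge0.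
have [x1|x1] := leP x 1.
  rewrite patchE mem_set/=; last by rewrite in_itv/= x0.
  rewrite ler_wpDr//.
  rewrite /gamma_fun ppowE// ler_piMr ?powR_ge0// expR_le1 oppr_le0.
  exact: ltW.
rewrite ler_wpDl//.
  by rewrite patchE; case: ifP => // _; rewrite powR_ge0.
rewrite exponential_pdfE ?(ltW x0)// /gamma_fun ppowE// /powR gt_eqF//.
rewrite mulrACA divff// mul1r -!expRD ler_expR.
have lnx : (a - 1) * ln x <= b * ln x.
  by rewrite ler_wpM2r ?ln_ge0 ?(ltW x1)// ler_norm.
have lnx2 : ln x <= e * x - ln e.
  have ex : 0 < e * x by rewrite mulr_gt0.
  have := ltW (ln_sublinear ex); rewrite lnM ?posrE// => ?.
  by rewrite lerBrDr addrC.
have : b * ln x <= b * (e * x - ln e) by rewrite ler_wpM2l.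
have : b * e * x <= 2^-1 * x by rewrite ler_wpM2r// ltW.
by move: lnx; rewrite mulrBr; lra.
Qed.

Lemma nnint_gamma_fun (a : R) : 0 < a -> nnint leb (gamma_fun a) (Gamma a).
Proof.
move=> a0; have [C C0 H] := gamma_fun_dominated a.
have mg := measurable_gamma_fun a.
pose h : R -> R := (fun x => x `^ (a - 1)) \_ `]0%R, 1%R].
have mh : measurable_fun setT h.
  apply/(measurable_restrictT _ _).1 => //; apply: measurable_funTS.
  exact: measurable_powR.
have h0 x : 0 <= h x by rewrite /h patchE; case: ifP => // _; exact: powR_ge0.
have me : measurable_fun setT (fun x : R => C * exponential_pdf 2^-1 x).
  by apply: measurable_funM => //; exact: measurable_exponential_pdf.
have e0 x : 0 <= C * exponential_pdf 2^-1 x.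
  by rewrite mulr_ge0// exponential_pdf_ge0.
have fin : (\int[leb]_x (gamma_fun a x)%:E < +oo)%E.
  apply: (@le_lt_trans _ _
    (\int[leb]_x ((h x)%:E + (C * exponential_pdf 2^-1 x)%:E))%E).
    apply: ge0_le_integral => //.
    - by move=> x _; rewrite lee_fin gamma_fun_ge0.
    - exact/measurable_EFinP.
    - by apply: emeasurable_funD; exact/measurable_EFinP.
    - by move=> x _; rewrite -EFinD lee_fin; exact: H.
  rewrite ge0_integralD//; first last.
  - exact/measurable_EFinP.
  - by move=> x _; rewrite lee_fin.
  - exact/measurable_EFinP.
  - by move=> x _; rewrite lee_fin.
  rewrite lte_add_pinfty//.
    rewrite (_ : (fun x => _) =
        (EFin \o (fun x => x `^ (a - 1))) \_ `]0%R, 1%R]); last first.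
      by rewrite restrict_EFin.
    by rewrite -integral_mkcond integral_powR01// ltry.
  under eq_integral do rewrite EFinM.
  rewrite ge0_integralZl_EFin//; last 2 first.
  - by move=> x _; rewrite lee_fin exponential_pdf_ge0.
  - by apply/measurable_EFinP; exact: measurable_exponential_pdf.
  by rewrite integral_exponential_pdf// mule1 ltry.
split => //; first by move=> x; exact: gamma_fun_ge0.
rewrite GammaE fineK// ge0_fin_numE//.
by apply: integral_ge0 => x _; rewrite lee_fin gamma_fun_ge0.
Qed.

Lemma Gamma_gt0 (a : R) : 0 < a -> 0 < Gamma a.
Proof.
move=> a0; have [mg g0 gE] := nnint_gamma_fun a0.
(* A lower bound for the integrand on the interval from 1 to 2, where [0 <= ln x <= 2] and
   [x <= 2]. *)
pose c := expR (- (2 * `|a - 1|) - 2).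
have nnI : nnint leb (\1_`[1%R, 2%R] : R -> R) 1.
  split => //; rewrite integral_indic//= setIT lebesgue_measure_itv/=.
  by rewrite lte_fin ltr1n -EFinD; congr EFin; ring.
have [mc c0 cE] := nnintZ (expR_ge0 (- (2 * `|a - 1|) - 2)) nnI.
apply: (@lt_le_trans _ _ (c * 1)); first by rewrite mulr1 expR_gt0.
rewrite -lee_fin -gE -cE; apply: ge0_le_integral.
- by [].
- by move=> x _; exact: c0.
- exact/measurable_EFinP.
- exact/measurable_EFinP.
move=> x _; rewrite lee_fin indicE; case: (boolP (x \in _)); last first.
  by rewrite mulr0 gamma_fun_ge0.
rewrite inE/= in_itv/= mulr1 => /andP[x1 x2].
have x0 : 0 < x by rewrite (lt_le_trans _ x1).
rewrite /gamma_fun ppowE// /powR gt_eqF// -expRD ler_expR.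
have : - (2 * `|a - 1|) <= (a - 1) * ln x.
  rewrite lerNl -mulNr (le_trans (ler_wpM2r _ (ler_norm _)))// ?ln_ge0//.
  rewrite normrN mulrC ler_wpM2r//.
  by rewrite (le_trans (ltW (ln_sublinear x0))).
by move: x2; lra.
Qed.

End gamma_function.

(** * Differentiating Gamma under the integral sign *)

Section gamma_derivable.
Context (R : realType).
Local Notation leb := (@lebesgue_measure R).

Lemma integrable_gamma_fun (a : R) : 0 < a ->
  leb.-integrable `]0%R, +oo[
    (EFin \o (fun t : R => t `^ (a - 1) * expR (- t))).
Proof.
move=> a0; apply/integrable_mkcond => //.
by rewrite restrict_EFin -gamma_funE; exact: nnint_integrable (nnint_gamma_fun a0).
Qed.

Lemma derive_gamma_integrand (t s : R) : 0 < t ->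
  is_derive s 1 (fun s => t `^ (s - 1) * expR (- t))
    (ln t * (t `^ (s - 1) * expR (- t))).
Proof.
move=> t0; have -> : (fun s => t `^ (s - 1) * expR (- t)) =
    (fun s => expR (s * ln t - (ln t + t))).
  apply/funext => r; rewrite /powR gt_eqF// -expRD; congr expR; ring.
have -> : t `^ (s - 1) * expR (- t) = expR (s * ln t - (ln t + t)).
  by rewrite /powR gt_eqF// -expRD; congr expR; ring.
have h : is_derive s 1 (fun s : R => s * ln t - (ln t + t)) (ln t).
  by apply: is_derive_eq; rewrite /GRing.scale /=; ring.
have := @is_derive1_comp R expR _ s _ _ (is_derive_expR _) h.
by rewrite mulrC.
Qed.

(* |ln t| <= (t ^ d + t ^ (- d)) / d and
   t ^ (x - 1) <= t ^ (a - d - 1) + t ^ (a + d - 1). *)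
Lemma gamma_integrand_derive_ub (a d t x : R) : 0 < d -> 0 < t ->
  a - d < x < a + d ->
  `|ln t| * (t `^ (x - 1) * expR (- t)) <=
  d^-1 * (2 * gamma_fun a t + (gamma_fun (a + 2 * d) t + gamma_fun (a - 2 * d) t)).
Proof.
move=> d0 t0 /andP[x1 x2]; rewrite /gamma_fun !ppowE// /powR gt_eqF//.
rewrite !mulrA -!mulrDl mulrA ler_wpM2r ?expR_ge0//.
set L := ln t; rewrite -ler_pdivrMl ?invr_gt0// invrK mulrA.
have dL : d * `|L| <= expR (d * L) + expR (- (d * L)).
  rewrite -{1}(gtr0_norm d0) -normrM ler_norml.
  have := expR_ge1Dx (d * L); have := expR_ge1Dx (- (d * L)).
  have := expR_ge0 (d * L); have := expR_ge0 (- (d * L)).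
  by move=> *; apply/andP; split; lra.
have xL : expR ((x - 1) * L) <= expR ((a - d - 1) * L) + expR ((a + d - 1) * L).
  have [L0|L0] := leP 0 L.
    by rewrite ler_wpDl ?expR_ge0// ler_expR ler_wpM2r//; lra.
  by rewrite ler_wpDr ?expR_ge0// ler_expR ler_wnM2r ?ltW//; lra.
have := ler_pM (mulr_ge0 (ltW d0) (normr_ge0 L)) (expR_ge0 _) dL xL.
move/le_trans; apply; rewrite mulrDl !mulrDr -!expRD.
have -> : d * L + (a - d - 1) * L = (a - 1) * L by ring.
have -> : d * L + (a + d - 1) * L = (a + 2 * d - 1) * L by ring.
have -> : - (d * L) + (a - d - 1) * L = (a - 2 * d - 1) * L by ring.
have -> : - (d * L) + (a + d - 1) * L = (a - 1) * L by ring.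
by lra.
Qed.

Lemma derivable_Gamma (a : R) : 0 < a -> derivable (@Gamma R) a 1.
Proof.
(* A third of [a] keeps [a - 2 * d] positive, so all three Gamma integrands in the dominating
   function are integrable. *)
move=> a0; pose d := a / 3; have d0 : 0 < d by rewrite divr_gt0.
pose f (s t : R) := t `^ (s - 1) * expR (- t).
pose G (t : R) := d^-1 * (2 * gamma_fun a t +
  (gamma_fun (a + 2 * d) t + gamma_fun (a - 2 * d) t)).
have aI : `](a - d), (a + d)[%classic a.
  by rewrite /= in_itv/=; apply/andP; split; lra.
have pos x : `](a - d), (a + d)[%classic x -> 0 < x.
  by rewrite /= in_itv/= => /andP[ax _]; apply: lt_trans ax; rewrite /d; lra.
apply: (@derivable_under_integral _ _ _ leb f `]0%R, +oo[%classic _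
  a (a - d) (a + d) aI _ _ G) => //.
- by move=> x /pos; exact: integrable_gamma_fun.
- move=> x t xI; rewrite /= in_itv/= andbT => t0.
  by have [] := derive_gamma_integrand x t0.
- move=> t; rewrite /G mulr_ge0 ?invr_ge0 ?(ltW d0)//.
  rewrite addr_ge0 ?(mulr_ge0 _ (gamma_fun_ge0 _ _))//.
  by rewrite addr_ge0 ?gamma_fun_ge0.
- apply: (@integrableS _ _ _ leb setT) => //.
  have ad2 : 0 < a + 2 * d by rewrite /d; lra.
  have ad2' : 0 < a - 2 * d by rewrite /d; lra.
  have dV0 : 0 <= d^-1 by rewrite invr_ge0 ltW.
  have := nnintD (nnintZ (ler0n R 2) (nnint_gamma_fun a0))
    (nnintD (nnint_gamma_fun ad2) (nnint_gamma_fun ad2')).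
  by move=> /(nnintZ dV0)/nnint_integrable.
- move=> x t xI; rewrite /= in_itv/= andbT => t0.
  have [_] := derive_gamma_integrand x t0; rewrite /partial1of2 derive1E => ->.
  rewrite normrM [X in _ * X]ger0_norm ?mulr_ge0 ?powR_ge0 ?expR_ge0//.
  by apply: gamma_integrand_derive_ub => //; rewrite /= in_itv in xI.
Qed.

End gamma_derivable.

(** * Beta integrals and the Dirichlet distribution *)
Section dirichlet.
Context (R : realType).
Local Notation leb := (@lebesgue_measure R).

Lemma sum_ord_gt0 n (a : 'I_n.+1 -> R) :
  (forall k, 0 < a k) -> 0 < \sum_k a k.
Proof.
by move=> a0; rewrite big_ord_recl ltr_pwDl// sumr_ge0// => k _; exact: ltW.
Qed.

Lemma prod_update n (g h : 'I_n -> R) k : g k != 0 ->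
  (forall j, j != k -> h j = g j) ->
  \prod_j h j = h k / g k * \prod_j g j.
Proof.
move=> gk hg; rewrite (bigD1 k)//= [in RHS](bigD1 k)//= mulrA divfK//.
by congr (_ * _); apply: eq_bigr => j /hg.
Qed.

Definition beta_integrand (a b s x : R) : R := ppow x (a - 1) * ppow (s - x) (b - 1).

Lemma beta_integrand_ge0 a b s x : 0 <= beta_integrand a b s x.
Proof. by rewrite mulr_ge0 ?ppow_ge0. Qed.

Lemma measurable_beta_integrand a b s :
  measurable_fun [set: measurableTypeR R] (beta_integrand a b s).
Proof.
apply: measurable_funM; first exact: measurable_ppow.
apply: (measurableT_comp (measurable_ppow _)).
exact: measurable_funB.
Qed.

Lemma beta_integrand_le0 a b s x : s <= 0 -> beta_integrand a b s x = 0.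
Proof.
move=> s0; rewrite /beta_integrand; have [x0|x0] := leP x 0.
  by rewrite ppow_le0 ?mul0r.
by rewrite [X in _ * X]ppow_le0 ?mulr0// subr_le0 (le_trans s0)// ltW.
Qed.

Lemma gamma_funM a b s x :
  gamma_fun a x * gamma_fun b (s - x) = expR (- s) * beta_integrand a b s x.
Proof.
rewrite /gamma_fun /beta_integrand mulrACA -expRD mulrC; congr (expR _ * _).
by ring.
Qed.

Lemma integral_beta_scale a b s : 0 < s ->
  (\int[leb]_x (beta_integrand a b s x)%:E =
   (s `^ (a + b - 1))%:E * \int[leb]_x (beta_integrand a b 1 x)%:E)%E.
Proof.
move=> s0; have mb := measurable_beta_integrand a b.
rewrite (ge0_integral_affine 0 s0); last 2 first.
- exact/measurable_EFinP.
- by move=> x; rewrite lee_fin beta_integrand_ge0.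
under eq_integral => x _.
  have -> : beta_integrand a b s (s * x + 0) =
      s `^ (a - 1) * s `^ (b - 1) * beta_integrand a b 1 x.
    rewrite /beta_integrand addr0 -{2}[s]mulr1 -mulrBr !ppowM//.
    by rewrite mulrACA.
  rewrite EFinM; over.
rewrite ge0_integralZl_EFin//; last 3 first.
- by move=> x _; rewrite lee_fin beta_integrand_ge0.
- exact/measurable_EFinP.
- by rewrite mulr_ge0 ?powR_ge0.
rewrite muleA -EFinM; congr (_%:E * _)%E.
rewrite -powRD; last by rewrite (gt_eqF s0) implybT.
rewrite -{1}(powRr1 (ltW s0)) -powRD; last by rewrite (gt_eqF s0) implybT.
by congr (_ `^ _); ring.
Qed.

(** Euler's argument: the product of two Gamma values is a double integral. Translating the inner
    variable and exchanging the order leaves, for each total [s], [expR (- s)] times a beta integral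
    at scale [s]; scaling that to 1 exposes the integrand of [Gamma (a + b)]. *)
Lemma nnint_beta a b s : 0 < a -> 0 < b -> 0 < s ->
  nnint leb (beta_integrand a b s)
    (s `^ (a + b - 1) * (Gamma a * Gamma b / Gamma (a + b))).
Proof.
move=> a0 b0 s0; have mb := measurable_beta_integrand a b.
have ab0 : 0 < a + b by rewrite addr_gt0.
split; [exact: mb|exact: beta_integrand_ge0|].
rewrite integral_beta_scale// EFinM; congr (_ * _)%E.
set I := (\int[leb]_x _)%E.
have I0 : (0 <= I)%E.
  by apply: integral_ge0 => x _; rewrite lee_fin beta_integrand_ge0.
have [ma ga0 gaE] := nnint_gamma_fun a0.
have [mgb gb0 gbE] := nnint_gamma_fun b0.
have [mab gab0 gabE] := nnint_gamma_fun ab0.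
(* [I] could still be infinite here. The identity is stated in the extended reals and itself
   excludes this, since its left side is finite and [Gamma (a + b)] is positive. *)
suff: ((Gamma a * Gamma b)%:E = (Gamma (a + b))%:E * I)%E.
  have G0 := Gamma_gt0 ab0; move: I I0 => [r _|_|//].
    by rewrite -EFinM => -[->]; rewrite mulrAC divff ?mul1r// gt_eqF.
  by rewrite gt0_muley ?lte_fin.
have mfs : measurable_fun setT (fun z : measurableTypeR R * measurableTypeR R =>
    (gamma_fun a z.1 * gamma_fun b (z.2 - z.1))%:E).
  apply/measurable_EFinP; apply: measurable_funM.
    exact: (measurableT_comp ma).
  apply: (measurableT_comp mgb); exact: measurable_funB.
transitivity (\int[leb]_x \int[leb]_s
    (gamma_fun a x * gamma_fun b (s - x))%:E)%E.
  rewrite EFinM -gaE -ge0_integralZr//; last 3 first.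
  - exact/measurable_EFinP.
  - by move=> x _; rewrite lee_fin.
  - by rewrite lee_fin ltW// Gamma_gt0.
  apply: eq_integral => x _.
  under [RHS]eq_integral do rewrite EFinM.
  rewrite ge0_integralZl_EFin//; last 2 first.
  - by move=> y _; rewrite lee_fin.
  - apply/measurable_EFinP; apply: (measurableT_comp mgb).
    exact: measurable_funB.
  congr (_ * _)%E; rewrite -gbE (ge0_integral_affine (- x) ltr01); last 2 first.
  - exact/measurable_EFinP.
  - by move=> y; rewrite lee_fin.
  by rewrite mul1e; apply: eq_integral => y _; rewrite mul1r.
rewrite (fubini_tonelli (fun z : measurableTypeR R * measurableTypeR R =>
    (gamma_fun a z.1 * gamma_fun b (z.2 - z.1))%:E))//; last first.
  by move=> z; rewrite lee_fin mulr_ge0.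
rewrite -gabE -ge0_integralZr//; last 2 first.
- exact/measurable_EFinP.
- by move=> x _; rewrite lee_fin.
apply: eq_integral => r _ /=.
under eq_integral do rewrite gamma_funM EFinM.
rewrite ge0_integralZl_EFin; last 4 first.
- exact: measurableT.
- by move=> x _; rewrite lee_fin beta_integrand_ge0.
- exact/measurable_EFinP.
- exact: expR_ge0.
have [r0|r0] := leP r 0.
  under eq_integral do rewrite beta_integrand_le0//.
  by rewrite integral0 mule0 /gamma_fun ppow_le0// mul0r mul0e.
by rewrite integral_beta_scale// muleA -EFinM /gamma_fun ppowE// [in RHS]mulrC.
Qed.

(** This is the beta integral with second parameter 1. The factor [Gamma 1] stays unevaluated
    because it cancels in the quotient that gives the Dirichlet mean. *)
Lemma GammaD1 (a : R) : 0 < a -> Gamma (a + 1) = a * (Gamma a * Gamma 1).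
Proof.
move=> a0; have [_ _] := nnint_beta a0 ltr01 ltr01.
have G1 : Gamma (a + 1) != 0 by rewrite gt_eqF// Gamma_gt0// addr_gt0.
have -> : (\int[leb]_x (beta_integrand a 1 1 x)%:E = a^-1%:E)%E.
  (* [ppow 0 0] is 0, so the beta integrand vanishes at [x = 1]; opening the interval discards that
     point. *)
  rewrite -(integral_powR01 a0) -integral_itv_bndo_bndc; last first.
    apply/measurable_EFinP; apply: measurable_funTS; exact: measurable_powR.
  rewrite [RHS]integral_mkcond; apply: eq_integral => x _.
  rewrite patchE; case: ifPn => [|].
    rewrite inE/= in_itv/= => /andP[x0 x1].
    by rewrite /beta_integrand !ppowE ?subr_gt0// subrr powRr0 mulr1.
  rewrite notin_setE/= in_itv/= => /negP; rewrite negb_and -!leNgt => /orP[x0|x1].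
    by rewrite /beta_integrand ppow_le0// mul0r.
  by rewrite /beta_integrand [X in _ * X]ppow_le0 ?mulr0// subr_le0.
move: (Gamma (a + 1)) (Gamma a * Gamma 1) G1 => u v u0.
rewrite powR1 mul1r => -[/(congr1 ( *%R (a * u)))].
by rewrite mulrAC mulfV ?gt_eqF// mul1r -mulrA (mulrCA u) mulfV// mulr1.
Qed.

(* [simplex_coord s r] completes the free coordinates [r] so that they sum to
   [s]; the scale [s] is what makes the induction on the dimension go through. *)
Definition simplex_coord n (s : R) (r : Rvec R n) (k : 'I_n.+1) : R :=
  nth (s - \sum_(x <- r) (x : R)) r k.

Definition dirichlet_integrand n (a : 'I_n.+1 -> R) (s : R) (r : Rvec R n) : R :=
  \prod_k ppow (simplex_coord s r k) (a k - 1).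

Lemma dirichlet_integrand_ge0 n a s (r : Rvec R n) :
  0 <= dirichlet_integrand a s r.
Proof. by apply: prodr_ge0 => k _; exact: ppow_ge0. Qed.

Lemma measurable_simplex_coord n s (k : 'I_n.+1) :
  measurable_fun setT (fun r : Rvec R n => simplex_coord s r k).
Proof.
have [kn|nk] := ltnP k n.
  rewrite (_ : (fun r => _) = (fun r : Rvec R n => tnth r (Ordinal kn))).
    exact: measurable_tnth.
  by apply/funext => r; rewrite (tnth_nth (s - \sum_(x <- r) (x : R))).
rewrite (_ : (fun r => _) = (fun r : Rvec R n => s - \sum_(i < n) tnth r i)).
  apply: measurable_funB => //; apply: measurable_sum => i.
  exact: measurable_tnth.
apply/funext => r; rewrite /simplex_coord nth_default ?size_tuple//.
by rewrite big_tuple.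
Qed.

Lemma measurable_dirichlet_integrand n (a : 'I_n.+1 -> R) s :
  measurable_fun setT (dirichlet_integrand a s).
Proof.
apply: measurable_prod => k _.
exact: (measurableT_comp (measurable_ppow _) (measurable_simplex_coord _ _)).
Qed.

Lemma simplex_coord_sum n s (r : Rvec R n) : \sum_k simplex_coord s r k = s.
Proof.
rewrite big_ord_recr /= {2}/simplex_coord nth_default ?size_tuple//.
rewrite [X in _ + (s - X)]big_tuple addrCA -[RHS]addr0; congr (_ + _).
apply/eqP; rewrite subr_eq0; apply/eqP; apply: eq_bigr => i _.
by rewrite /simplex_coord -tnth_nth.
Qed.

(** A nonzero product forces every coordinate to be positive, and the coordinates sum to [s]. *)
Lemma dirichlet_integrand_le0 n (a : 'I_n.+1 -> R) s r :
  s <= 0 -> dirichlet_integrand a s r = 0.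
Proof.
move=> s0; apply/eqP; apply: contraLR s0 => /prodf_neq0 r0; rewrite -ltNge.
rewrite -(simplex_coord_sum s r); apply: sum_ord_gt0 => k.
by rewrite ltNge; apply: contra_neqN (r0 k isT); exact: ppow_le0.
Qed.

Lemma dirichlet_integrand_cons n (a : 'I_n.+2 -> R) s x (r : Rvec R n) :
  dirichlet_integrand a s (tuple_cons (x, r)) =
  ppow x (a ord0 - 1) * dirichlet_integrand (fun k => a (lift ord0 k)) (s - x) r.
Proof.
rewrite /dirichlet_integrand big_ord_recl; congr (_ * _).
apply: eq_bigr => k _; congr ppow; rewrite /simplex_coord /= big_cons.
by rewrite opprD addrA.
Qed.

(** Once the first coordinate [x] is fixed, the others form a Dirichlet integral at scale [s - x].
    Its value is a power of [s - x], so a beta integral in [x] remains, whose second parameter is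
    the sum of the other concentrations. *)
Lemma nnint_dirichlet n (a : 'I_n.+1 -> R) s : (forall k, 0 < a k) -> 0 < s ->
  nnint (lebesgue_vec R n) (dirichlet_integrand a s)
    (s `^ (\sum_k a k - 1) * (\prod_k Gamma (a k) / Gamma (\sum_k a k))).
Proof.
move=> a0 s0; split.
- exact: measurable_dirichlet_integrand.
- exact: dirichlet_integrand_ge0.
elim: n => [|n IH] in a a0 s s0 *.
  rewrite /lebesgue_vec integral_tuple_measure0; last first.
    by apply/measurable_EFinP; exact: measurable_dirichlet_integrand.
  rewrite !big_ord1 divff ?gt_eqF ?Gamma_gt0// mulr1.
  by rewrite /dirichlet_integrand big_ord1 /simplex_coord /= big_nil subr0 ppowE.
pose a' k := a (lift ord0 k).
have a'0 k : 0 < a' k by exact: a0.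
have sa'0 := sum_ord_gt0 a'0.
rewrite /lebesgue_vec ge0_integral_tuple_measureS; last 2 first.
- by apply/measurable_EFinP; exact: measurable_dirichlet_integrand.
- by move=> r; rewrite lee_fin dirichlet_integrand_ge0.
rewrite fubini_tonelli1; last 2 first.
- apply/measurable_EFinP.
  exact: (measurableT_comp (measurable_dirichlet_integrand a s)
    (@measurable_tuple_cons _ (measurableTypeR R) n)).
- by move=> z; rewrite lee_fin dirichlet_integrand_ge0.
rewrite /fubini_F /=.
set C := \prod_k Gamma (a' k) / Gamma (\sum_k a' k).
transitivity (\int[leb]_x (C * beta_integrand (a ord0) (\sum_k a' k) s x)%:E)%E.
  apply: eq_integral => x _.
  under eq_integral do rewrite dirichlet_integrand_cons EFinM.
  rewrite ge0_integralZl_EFin ?ppow_ge0//; last 2 first.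
  - by move=> r _; rewrite lee_fin dirichlet_integrand_ge0.
  - by apply/measurable_EFinP; exact: measurable_dirichlet_integrand.
  have [sx|sx] := leP (s - x) 0.
    under eq_integral do rewrite dirichlet_integrand_le0//.
    by rewrite integral0 mule0 /beta_integrand [X in _ * (_ * X)]ppow_le0// !mulr0.
  rewrite (IH a' a'0 _ sx) -EFinM /beta_integrand [X in _ = (_ * (_ * X))%:E]ppowE//.
  by congr EFin; rewrite [LHS]mulrA [RHS]mulrC.
have C0 : 0 <= C.
  by apply: divr_ge0; [apply: prodr_ge0 => k _|]; rewrite ltW// Gamma_gt0.
have [_ _ ->] := nnintZ C0 (nnint_beta (a0 ord0) sa'0 s0).
have -> : \sum_k a k = a ord0 + \sum_k a' k by rewrite big_ord_recl.
have -> : \prod_k Gamma (a k) = Gamma (a ord0) * \prod_k Gamma (a' k).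
  by rewrite big_ord_recl.
rewrite mulrCA /C; congr (_ * _)%:E.
have Gn0 (c : R) : 0 < c -> Gamma c != 0 by move=> c0; rewrite gt_eqF// Gamma_gt0.
move: (Gn0 _ sa'0) (Gn0 _ (addr_gt0 (a0 ord0) sa'0)).
move: (Gamma (_ + _)) (Gamma (\sum_k _)) (Gamma (a _)) => u v w v0 u0.
by field; rewrite u0 v0.
Qed.

Lemma dirichlet_pdfE n (a : 'I_n.+1 -> R) (r : Rvec R n) :
  dirichlet_pdf a r =
  Gamma (\sum_k a k) / (\prod_k Gamma (a k)) * dirichlet_integrand a 1 r.
Proof.
rewrite /dirichlet_pdf; case: ifPn => [/forallP r0|].
  congr (_ * _); apply: eq_bigr => k _.
  by rewrite /simplex_coord ppowE//; exact: r0.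
rewrite negb_forall => /existsP[k]; rewrite -leNgt => rk.
by rewrite /dirichlet_integrand [X in _ / _ * X](bigD1 k)//= ppow_le0// mul0r mulr0.
Qed.

Lemma dirichlet_normalizer_gt0 n (a : 'I_n.+1 -> R) : (forall k, 0 < a k) ->
  0 < Gamma (\sum_k a k) / (\prod_k Gamma (a k)).
Proof.
move=> a0; rewrite divr_gt0 ?prodr_gt0 ?Gamma_gt0 ?sum_ord_gt0// => k _.
exact: Gamma_gt0.
Qed.

Lemma nnint_dirichlet_pdf n (a : 'I_n.+1 -> R) : (forall k, 0 < a k) ->
  nnint (lebesgue_vec R n) (@dirichlet_pdf R n.+1 a) 1.
Proof.
move=> a0; have N0 := dirichlet_normalizer_gt0 a0.
apply: eq_nnint (nnintZ (ltW N0) (nnint_dirichlet a0 ltr01)).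
  by move=> r; rewrite dirichlet_pdfE.
by rewrite powR1 mul1r -[X in _ * X]invf_div divff// gt_eqF.
Qed.

(* Multiplying the density by [rho_k ^ e] shifts the k-th concentration by
   [e], so every moment is a quotient of Gamma values. *)
Lemma nnint_dirichlet_moment n (a : 'I_n.+1 -> R) k e :
  (forall j, 0 < a j) -> 0 < a k + e ->
  nnint (lebesgue_vec R n)
    (fun r => ppow (simplex_coord 1 r k) e * dirichlet_pdf a r)
    (Gamma (a k + e) / Gamma (a k) *
     (Gamma (\sum_j a j) / Gamma (\sum_j a j + e))).
Proof.
move=> a0 ake0; have N0 := dirichlet_normalizer_gt0 a0.
pose b j := if j == k then a k + e else a j.
have b0 j : 0 < b j by rewrite /b; case: ifP.
apply: eq_nnint (nnintZ (ltW N0) (nnint_dirichlet b0 ltr01)).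
  move=> r; rewrite dirichlet_pdfE mulrCA; congr (_ * _).
  rewrite /dirichlet_integrand (bigD1 k)//= [in RHS](bigD1 k)//= mulrA.
  congr (_ * _); last first.
    by apply: eq_bigr => j /negbTE jk; rewrite /b jk.
  rewrite /b eqxx; have [rk|rk] := leP (simplex_coord 1 r k) 0.
    by rewrite !ppow_le0// mul0r.
  rewrite !ppowE// -powRD; last by rewrite (gt_eqF rk) implybT.
  by congr (_ `^ _); ring.
have sb0 := sum_ord_gt0 b0.
have sbE : \sum_j b j = \sum_j a j + e.
  rewrite (bigD1 k)//= [in RHS](bigD1 k)//= /b eqxx addrAC; congr (_ + _ + _).
  by apply: eq_bigr => j /negbTE ->.
rewrite sbE in sb0 *.
have Gn0 (c : R) : 0 < c -> Gamma c != 0 by move=> c0; rewrite gt_eqF// Gamma_gt0.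
rewrite (@prod_update _ (fun j => Gamma (a j)) (fun j => Gamma (b j)) k).
- have -> : b k = a k + e by rewrite /b eqxx.
  have P0 : \prod_j Gamma (a j) != 0 by apply/prodf_neq0 => j _; exact: Gn0.
  move: (Gn0 _ sb0) (Gn0 _ (a0 k)) P0; rewrite powR1 mul1r.
  move: (Gamma (_ + e)) (Gamma (_ + e)) (Gamma (a k)) (Gamma (\sum_j _)) => t u v w.
  by move: (\prod_j _) => x t0 v0 x0; field; rewrite t0 v0 x0.
- exact: Gn0.
- by move=> j /negbTE jk; rewrite /b jk.
Qed.

Lemma nnint_dirichlet_mean n (a : 'I_n.+1 -> R) k : (forall j, 0 < a j) ->
  nnint (lebesgue_vec R n)
    (fun r => ppow (simplex_coord 1 r k) 1 * dirichlet_pdf a r)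
    (a k / \sum_j a j).
Proof.
move=> a0; have s0 := sum_ord_gt0 a0.
have Gn0 (c : R) : 0 < c -> Gamma c != 0 by move=> c0; rewrite gt_eqF// Gamma_gt0.
apply: eq_nnint (nnint_dirichlet_moment a0 (addr_gt0 (a0 k) ltr01)) => //.
rewrite !GammaD1//.
move: (Gamma _) (Gamma _) (Gamma _) (Gn0 _ (a0 k)) (Gn0 _ s0) (Gn0 _ ltr01).
by move=> u v w u0 v0 w0; field; rewrite u0 v0 w0 gt_eqF.
Qed.

End dirichlet.

(** * The logarithmic moment of a Dirichlet law *)

Section log_moment.
Context (R : realType).
Local Notation leb := (@lebesgue_measure R).

Lemma is_derive_lnGamma (a : R) : 0 < a ->
  is_derive a 1 (fun s => ln (Gamma s)) (digamma a).
Proof.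
move=> a0; have G0 := Gamma_gt0 a0.
have dl := is_derive1_comp (is_derive1_ln G0) (DeriveDef (derivable_Gamma a0) erefl).
have dd : derivable (fun s => ln (Gamma s)) a 1 by case: dl.
by apply: DeriveDef; [exact: dd|rewrite /digamma derive1E].
Qed.

Lemma is_derive_le_quotient (h : R -> R) (l b d : R) :
  is_derive (0 : R) 1 h l -> 0 < d ->
  (forall e, 0 < e < d -> b <= e^-1 * (h e - h 0)) -> b <= l.
Proof.
move=> [dh hl] d0 H.
have cv : e^-1 * (h e - h 0) @[e --> 0^'+] --> l.
  apply: cvg_dnbhs_at_right.
  rewrite -hl; move: dh => /cvg_ex[/= L hL].
  have -> : 'D_1 h 0 = L by apply/cvg_lim.
  apply: cvg_trans hL; apply: near_eq_cvg; apply: nearW => e /=.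
  by rewrite /GRing.scale /= mulr1 addr0.
apply: (cvgr_to_ge cv); near=> e; apply: H; apply/andP; split.
  by near: e; exact: nbhs_right_gt.
by near: e; exact: nbhs_right_lt.
Unshelve. all: by end_near. Qed.

(* - ln p <= (p ^ (- e) - 1) / e for every e > 0; the mean of the right-hand
   side is a difference quotient, at 0, of a ratio of Gamma values. *)
Lemma dirichlet_log_moment n (a : 'I_n.+1 -> R) k : (forall j, 0 < a j) ->
  exists2 b, nnint (lebesgue_vec R n)
    (fun r => - ln (simplex_coord 1 r k) * dirichlet_pdf a r) b &
  b <= digamma (\sum_j a j) - digamma (a k).
Proof.
move=> a0; have [mD D0 _] := nnint_dirichlet_pdf a0.
pose f (r : Rvec R n) := - ln (simplex_coord 1 r k) * dirichlet_pdf a r.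
pose M e := Gamma (a k - e) / Gamma (a k) *
  (Gamma (\sum_j a j) / Gamma (\sum_j a j - e)).
have mf : measurable_fun setT f.
  apply: measurable_funM => //; apply: measurableT_comp => //.
  by apply: measurableT_comp; [exact: measurable_ln|exact: measurable_simplex_coord].
have sk : a k <= \sum_j a j.
  by rewrite (bigD1 k)//= lerDl sumr_ge0// => j _; exact: ltW.
have supp r : dirichlet_pdf a r != 0 -> 0 < simplex_coord 1 r k <= 1.
  rewrite /dirichlet_pdf; case: ifP => [/forallP r0 _|]; last by rewrite eqxx.
  rewrite [X in X && _]r0/= -[leRHS](simplex_coord_sum 1 r) (bigD1 k)//= lerDl.
  by apply: sumr_ge0 => j _; exact/ltW/r0.
have f_ge0 r : 0 <= f r.
  have [r0|/supp/andP[p0 p1]] := eqVneq (dirichlet_pdf a r) 0.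
    by rewrite /f r0 mulr0.
  by rewrite mulr_ge0// oppr_ge0 ln_le0.
have key e : 0 < e < a k -> exists2 b, nnint (lebesgue_vec R n) f b &
    b <= e^-1 * (M e - 1).
  move=> /andP[e0 ek]; have ake : 0 < a k + - e by rewrite subr_gt0.
  have eV0 : 0 <= e^-1 by rewrite invr_ge0 ltW.
  have le1 r : dirichlet_pdf a r <=
      ppow (simplex_coord 1 r k) (- e) * dirichlet_pdf a r.
    have [->|/supp/andP[p0 p1]] := eqVneq (dirichlet_pdf a r) 0.
      by rewrite mulr0.
    rewrite ler_peMl// ppowE// /powR gt_eqF// -[leLHS]expR0 ler_expR mulNr -mulrN.
    by rewrite mulr_ge0 ?(ltW e0)// oppr_ge0 ln_le0.
  have := nnintZ eV0 (nnintB le1 (nnint_dirichlet_moment a0 ake)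
    (nnint_dirichlet_pdf a0)).
  apply: nnint_le => // r; rewrite f_ge0 /f /=.
  have [->|/supp/andP[p0 p1]] := eqVneq (dirichlet_pdf a r) 0.
    by rewrite !mulr0 subrr mulr0.
  rewrite -{3}[dirichlet_pdf a r]mul1r -mulrBl mulrA ler_wpM2r//.
  rewrite ler_pdivlMl// ppowE// /powR gt_eqF// lerBrDl mulrN -mulNr.
  exact: expR_ge1Dx.
(* One admissible exponent suffices to fix the value [b]; the bounds from all other exponents then
   concern this same number, since the integral is unique. *)
have [b fb _] : exists2 b, nnint (lebesgue_vec R n) f b &
    b <= (a k / 2)^-1 * (M (a k / 2) - 1).
  by apply: key; have := a0 k; move=> ?; apply/andP; split; lra.
exists b => //.
have sn0 : 0 < \sum_j a j by rewrite (lt_le_trans (a0 k)).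
pose lG s : R := ln (Gamma s).
(* As [L 0 = 0], the derivative of [M = expR \o L] at 0 is that of [L], a difference of digamma
   values. *)
pose L e := lG (a k - e) - lG (a k) + (lG (\sum_j a j) - lG (\sum_j a j - e)).
have ML e : e < a k -> M e = expR (L e).
  move=> ek; have expE (x y z w : R) : 0 < x -> 0 < y -> 0 < z -> 0 < w ->
      expR (ln x - ln y + (ln z - ln w)) = x / y * (z / w).
    by move=> *; rewrite expRD !expRB !lnK.
  rewrite /M /L /lG expE; [by []|apply: Gamma_gt0..].
  - by rewrite subr_gt0.
  - exact: a0.
  - exact: sn0.
  - by rewrite subr_gt0 (lt_le_trans ek sk).
have dS c : 0 < c -> is_derive (0 : R) 1 (fun e => lG (c - e)) (- digamma c).
  move=> c0; have h1 : is_derive (0 : R) 1 (fun e => c - e) (-1).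
    have := is_deriveB (is_derive_cst c (0 : R) 1) (is_derive_id (0 : R) 1).
    by rewrite sub0r.
  have c0' : 0 < c - 0 by rewrite subr0.
  have := @is_derive1_comp R lG (fun e => c - e) 0 _ _ (is_derive_lnGamma c0') h1.
  by rewrite subr0 mulrN1.
have dL : is_derive (0 : R) 1 L (digamma (\sum_j a j) - digamma (a k)).
  have h1 := is_deriveB (dS _ (a0 k)) (is_derive_cst (lG (a k)) (0 : R) 1).
  have h2 := is_deriveB (is_derive_cst (lG (\sum_j a j)) (0 : R) 1) (dS _ sn0).
  apply: (@is_derive_eq _ _ _ L 0 1 _ _ (is_deriveD h1 h2)).
  by move: (digamma (a k)) (digamma _) => u v; ring.
have dE := @is_derive1_comp R expR L 0 _ _ (is_derive_expR (L 0)) dL.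
have L0 : L 0 = 0 by rewrite /L (subr0 (a k)) (subr0 (\sum_j a j)) !subrr addr0.
rewrite L0 expR0 mul1r in dE.
apply: (is_derive_le_quotient dE (a0 k)) => e /andP[e0 ek].
rewrite /= L0 expR0 -ML//; have [|c [_ _ fc] ce] := key e; first by rewrite e0.
by case: fb => _ _; rewrite fc => -[<-].
Qed.

End log_moment.

(** * The evidence lower bound *)
Section evidence_lower_bound.
Context (R : realType).

(** [h] may fail to be integrable, as the divergence integrand does when the divergence is infinite;
    positive and negative parts are compared separately. *)
Lemma le_integral_integrable d (T : measurableType d)
    (mu : {measure set T -> \bar R}) (g h : T -> \bar R) :
  mu.-integrable setT g -> measurable_fun setT h -> (forall x, g x <= h x)%E ->
  (\int[mu]_x g x <= \int[mu]_x h x)%E.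
Proof.
move=> gi mh gh; have mg := measurable_int _ gi.
rewrite [leLHS]integralE [leRHS]integralE; apply: leeB.
  apply: ge0_le_integral => //; [exact: measurable_funepos..|].
  by move=> x _; apply: (@funepos_le _ _ setT); rewrite ?inE.
apply: ge0_le_integral => //; [exact: measurable_funeneg..|].
by move=> x _; apply: (@funeneg_le _ _ setT); rewrite ?inE.
Qed.

Lemma nnint_sum d (T : measurableType d) (mu : {measure set T -> \bar R})
    n (f : 'I_n -> T -> R) (b : 'I_n -> R) :
  (forall i, nnint mu (f i) (b i)) ->
  nnint mu (fun x => \sum_i f i x) (\sum_i b i).
Proof.
elim: n => [|n IH] in f b * => fb.
  apply: eq_nnint (_ : nnint mu (fun=> 0) 0).
  - by move=> x; rewrite big_ord0.
  - by rewrite big_ord0.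
  - by split => //; rewrite integral0.
apply: eq_nnint (nnintD (fb ord0) (IH _ _ (fun i => fb (lift ord0 i)))).
- by move=> x; rewrite big_ord_recl.
- by rewrite big_ord_recl.
Qed.

Section posterior_moments.
Variables (n m : nat).
Variables (a : 'I_n.+1 -> R) (mean : 'I_n.+1 -> 'cV[R]_m) (S : 'I_n.+1 -> 'M[R]_m).
Hypotheses (a_gt0 : forall k, 0 < a k) (S_pd : forall k, sym_posdef (S k)).
Let P := param_measure R m n.+1.
Let q : param R m n.+1 -> R := param_pdf a mean S.

Lemma nnint_param (g : Rvec R n -> R) (h : 'I_n.+1 -> Rvec R m -> R) b c :
  nnint (lebesgue_vec R n) g b -> (forall k, nnint (lebesgue_vec R m) (h k) (c k)) ->
  nnint P (fun xi => g xi.1 * \prod_k h k (tnth xi.2 k)) (b * \prod_k c k).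
Proof. by move=> gb hc; exact: (nnint_prod gb (nnint_tuple hc)). Qed.

Lemma nnint_param_pdf : nnint P q 1.
Proof.
have gk k := nnint_gauss_pdf (mean k) (S_pd k).
apply: eq_nnint (nnint_param (nnint_dirichlet_pdf a_gt0) gk) => //.
by rewrite mul1r big1.
Qed.

Lemma nnint_param_pdf_rho (phi : Rvec R n -> R) b :
  nnint (lebesgue_vec R n) (fun r => phi r * dirichlet_pdf a r) b ->
  nnint P (fun xi => phi xi.1 * q xi) b.
Proof.
move=> phib; have gk k := nnint_gauss_pdf (mean k) (S_pd k).
apply: eq_nnint (nnint_param phib gk).
  by move=> xi; rewrite /q /param_pdf mulrA.
by rewrite big1 ?mulr1.
Qed.

(** By independence the Gaussian factors other than the [k]-th integrate to 1, so the mean of the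
    product factors. *)
Lemma nnint_param_pdf_mix (phi : Rvec R n -> R) (chi : Rvec R m -> R) k b c :
  nnint (lebesgue_vec R n) (fun r => phi r * dirichlet_pdf a r) b ->
  nnint (lebesgue_vec R m)
    (fun v => chi v * gauss_pdf (mean k) (S k) (vec_of v)) c ->
  nnint P (fun xi => phi xi.1 * chi (tnth xi.2 k) * q xi) (b * c).
Proof.
move=> phib chic.
pose h j (v : Rvec R m) := (if j == k then chi v else 1) *
  gauss_pdf (mean j) (S j) (vec_of v).
have hj j : nnint (lebesgue_vec R m) (h j) (if j == k then c else 1).
  rewrite /h; case: eqVneq => [->//|_].
  by apply: eq_nnint (nnint_gauss_pdf (mean j) (S_pd j)) => // v; rewrite mul1r.
apply: eq_nnint (nnint_param phib hj).
  move=> xi; rewrite /q /param_pdf.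
  rewrite (bigD1 k)//= [in RHS](bigD1 k)//= /h eqxx.
  have -> : \prod_(j < n.+1 | j != k) ((if j == k then chi (tnth xi.2 j) else 1) *
      gauss_pdf (mean j) (S j) (vec_of (tnth xi.2 j))) =
      \prod_(j < n.+1 | j != k) gauss_pdf (mean j) (S j) (mu_of xi j).
    by apply: eq_bigr => j /negbTE ->; rewrite mul1r.
  by rewrite /mu_of; ring.
rewrite (bigD1 k)//= eqxx big1 ?mulr1// => j /negbTE -> //.
Qed.

Lemma param_pdf_log_rho k :
  exists2 b, nnint P (fun xi => - ln (rho_of xi k) * q xi) b &
  b <= digamma (\sum_j a j) - digamma (a k).
Proof.
have [b rb le_b] := dirichlet_log_moment k a_gt0.
by exists b => //; exact: (nnint_param_pdf_rho rb).
Qed.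

Lemma param_pdf_qform (Q : 'M[R]_m) (f : 'cV[R]_m) k : sym_posdef Q ->
  exists2 b, nnint P (fun xi => qform Q (f - mu_of xi k) / 2 * q xi) b &
  b <= (qform Q (f - mean k) + \tr (Q *m S k)) / 2.
Proof.
move=> sQ; have [b gb le_b] := gauss_pdf_qform_moment (mean k) f (S_pd k) sQ.
exists b => //.
have D1 : nnint (lebesgue_vec R n) (fun r => 1 * dirichlet_pdf a r) 1.
  by apply: eq_nnint (nnint_dirichlet_pdf a_gt0) => // r; rewrite mul1r.
apply: eq_nnint (nnint_param_pdf_mix D1 gb); last by rewrite mul1r.
by move=> xi; rewrite mul1r.
Qed.

Lemma dirichlet_pdf_supp (r : Rvec R n) k :
  dirichlet_pdf a r != 0 -> 0 < simplex_coord 1 r k.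
Proof.
by rewrite /dirichlet_pdf; case: ifP => [/forallP r0 _|]; [exact: r0|rewrite eqxx].
Qed.

Lemma nnint_joint_pdf (Sigma : 'M[R]_m) (f : 'cV[R]_m) k : sym_posdef Sigma ->
  nnint P (fun xi => joint_pdf Sigma xi f k * q xi)
    (a k / (\sum_j a j) * gauss_pdf (mean k) (Sigma + S k) f).
Proof.
move=> sS.
apply: eq_nnint (nnint_param_pdf_mix (nnint_dirichlet_mean k a_gt0)
  (nnint_gauss_pdf_conv (mean k) f (S_pd k) sS)) => // xi.
rewrite /joint_pdf /q /param_pdf.
(* [ppow _ 1] and the coordinate itself agree only where the latter is nonnegative, which covers the
   support of the density. *)
have [->|/dirichlet_pdf_supp r0] := eqVneq (dirichlet_pdf a xi.1) 0.
  by rewrite mul0r !mulr0.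
by rewrite ppowE// powRr1// ltW.
Qed.

End posterior_moments.

End evidence_lower_bound.

(** * Pointwise inequalities and their integration *)

Section elbo.
Context (R : realType).

Lemma ln_le_ratio (s c : R) : 0 < s -> 0 < c -> ln s <= ln c + (s / c - 1).
Proof.
move=> s0 c0; rewrite addrC -lerBlDr -ln_div ?posrE//.
rewrite -[X in ln X](subrK 1) addrC le_ln1Dx//.
by rewrite ltrBrDl subrr divr_gt0.
Qed.

(* [z] is a guess for the evidence; keeping it arbitrary lets zero evidence be
   treated as well. *)
Lemma gibbs_pointwise (q p L z : R) : 0 < q -> 0 < p -> 0 < L -> 0 < z ->
  q * (ln L - ln z + 1) - L * p / z <= q * ln (q / p).
Proof.
move=> q0 p0 L0 z0; rewrite ln_div ?posrE//.
have := ln_le_ratio (mulr_gt0 L0 p0) (mulr_gt0 z0 q0); rewrite !lnM ?posrE//.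
have -> : L * p / z = q * (L * p / (z * q)) by field; rewrite !gt_eqF.
by rewrite -mulrBr ler_pM2l//; lra.
Qed.

(** Shape of the minorant of the divergence integrand: constants multiply the posterior density [q],
    and the rest is subtracted as one nonnegative [N]. *)
Lemma integral_affine_nnint d (T : measurableType d)
    (mu : {measure set T -> \bar R}) (K : R) (q N : T -> R) b c :
  nnint mu q b -> nnint mu N c ->
  mu.-integrable setT (EFin \o (fun x => K * q x - N x)) /\
  (\int[mu]_x (K * q x - N x)%:E = (K * b - c)%:E)%E.
Proof.
move=> qb Nc; have qi := nnint_integrable qb; have Ni := nnint_integrable Nc.
have Kqi : mu.-integrable setT (EFin \o (fun x => K * q x)).
  by rewrite /comp; under eq_fun do rewrite EFinM; exact: integrableZl.
split.
  by rewrite /comp; under eq_fun do rewrite EFinB; exact: integrableB.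
under eq_integral do rewrite EFinB.
rewrite integralB_EFin//; under eq_integral do rewrite EFinM.
rewrite integralZl//; case: qb Nc => _ _ -> [_ _ ->].
by rewrite -EFinM -EFinB.
Qed.

Lemma param_pdf_supp n m (a : 'I_n.+1 -> R) mean (S : 'I_n.+1 -> 'M[R]_m)
    (xi : param R m n.+1) k :
  param_pdf a mean S xi != 0 -> 0 < rho_of xi k.
Proof.
rewrite /param_pdf mulf_eq0 negb_or => /andP[r0 _].
exact: (dirichlet_pdf_supp k r0).
Qed.

Lemma param_pdf_gt0 n m (a : 'I_n.+1 -> R) mean (S : 'I_n.+1 -> 'M[R]_m)
    (xi : param R m n.+1) :
  (forall k, 0 < a k) -> (forall k, sym_posdef (S k)) ->
  (forall k, 0 < rho_of xi k) -> 0 < param_pdf a mean S xi.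
Proof.
move=> a0 S0 r0; apply: mulr_gt0.
  rewrite dirichlet_pdfE mulr_gt0 ?dirichlet_normalizer_gt0// prodr_gt0// => k _.
  by rewrite ppowE ?powR_gt0//; exact: r0.
by apply: prodr_gt0 => k _; exact: gauss_pdf_gt0.
Qed.

Lemma measurable_joint_pdf n m (Sigma : 'M[R]_m) (f : 'cV[R]_m) (k : 'I_n.+1) :
  measurable_fun setT (fun xi : Rvec R n * n.+1.-tuple (Rvec R m) =>
    joint_pdf Sigma (xi : param R m n.+1) f k).
Proof.
apply: measurable_funM.
  exact: (measurableT_comp (measurable_simplex_coord 1 k) measurable_fst).
apply: measurable_funM => //; apply: measurableT_comp => //.
apply: measurable_funM => //; apply: measurableT_comp => //.
apply: (@measurable_qform _ _ _ _ (invmx Sigma)) => i.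
under eq_fun do rewrite !mxE.
apply: measurable_funB => //; apply: (measurableT_comp (measurable_tnth i)).
exact: (measurableT_comp (measurable_tnth k) measurable_snd).
Qed.

Section bound.
Variables (n m T : nat).
Variables (alpha0 alpha : 'I_n.+1 -> R) (mu0 mu : 'I_n.+1 -> 'cV[R]_m).
Variables (S0 S : 'I_n.+1 -> 'M[R]_m) (Sigma : 'M[R]_m).
Variables (f : 'I_T -> 'cV[R]_m) (y : 'I_T -> 'I_n.+1).
Hypotheses (alpha0_gt0 : forall k, 0 < alpha0 k) (alpha_gt0 : forall k, 0 < alpha k).
Hypotheses (S0_pd : forall k, sym_posdef (S0 k)) (S_pd : forall k, sym_posdef (S k)).
Hypothesis Sigma_pd : sym_posdef Sigma.
Let P := param_measure R m n.+1.
Let p := param_pdf alpha0 mu0 S0.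
Let q := param_pdf alpha mu S.

(** Prior and posterior densities are both positive exactly on the open simplex, so the infinite
    branch is never reached. *)
Lemma kl_div_param_pdfE :
  kl_div P q p = (\int[P]_xi (q xi * (ln (q xi) - ln (p xi)))%:E)%E.
Proof.
apply: eq_integral => xi _; case: ifPn => [/eqP ->|q0]; first by rewrite mul0r.
have r0 k := param_pdf_supp k q0.
have qp : 0 < q xi by exact: param_pdf_gt0.
have pp : 0 < p xi by exact: param_pdf_gt0.
by rewrite gt_eqF// ln_div.
Qed.

Lemma joint_pdf_gt0 (xi : param R m n.+1) g k :
  0 < rho_of xi k -> 0 < joint_pdf Sigma xi g k.
Proof. by move=> r0; rewrite mulr_gt0// gauss_pdf_gt0. Qed.

Lemma class_prob_gt0 (xi : param R m n.+1) g k :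
  (forall j, 0 < rho_of xi j) -> 0 < class_prob Sigma xi g k.
Proof.
by move=> r0; rewrite divr_gt0 ?sum_ord_gt0// => *; exact: joint_pdf_gt0.
Qed.

Let L (xi : param R m n.+1) := \prod_(t < T) class_prob Sigma xi (f t) (y t).

(** Off the simplex a class probability can be negative, but [p] vanishes there. *)
Let Lp_ge0 xi : 0 <= L xi * p xi.
Proof.
have [->|p0] := eqVneq (p xi) 0; first by rewrite mulr0.
have r0 k := param_pdf_supp k p0.
apply: mulr_ge0; first by apply: prodr_ge0 => t _; exact/ltW/class_prob_gt0.
exact/ltW/param_pdf_gt0.
Qed.

Let measurable_Lp : measurable_fun setT (fun xi => L xi * p xi).
Proof.
(* The quotients become exponentials of differences of logarithms, built from measurable pieces. The
   two expressions agree where [p] is positive, and elsewhere the factor [p xi] is 0. *)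
rewrite (_ : (fun xi => _) = (fun xi => expR (\sum_(t < T)
    (ln (joint_pdf Sigma xi (f t) (y t))
     - ln (\sum_j joint_pdf Sigma xi (f t) j))) * p xi)).
  have [mp _ _] := nnint_param_pdf mu0 alpha0_gt0 S0_pd.
  apply: measurable_funM => //; apply: measurableT_comp => //.
  apply: measurable_sum => t; apply: measurable_funB.
    apply: measurableT_comp; first exact: measurable_ln.
    exact: measurable_joint_pdf.
  apply: measurableT_comp; first exact: measurable_ln.
  by apply: measurable_sum => j; exact: measurable_joint_pdf.
apply/funext => xi; have [->|p0] := eqVneq (p xi) 0; first by rewrite !mulr0.
have r0 k := param_pdf_supp k p0.
congr (_ * _); rewrite expR_sum; apply: eq_bigr => t _.
rewrite expRB !lnK ?posrE ?joint_pdf_gt0//.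
by apply: sum_ord_gt0 => j; exact: joint_pdf_gt0.
Qed.

Let Q := invmx Sigma.
Let lnk := ln (Num.sqrt ((2 * pi) ^+ m * \det Sigma))^-1.
Let asum := \sum_j alpha j.
Let s0 t := \sum_j alpha j / asum * gauss_pdf (mu j) (Sigma + S j) (f t).

Lemma ln_gauss_pdf v g : ln (gauss_pdf v Sigma g) = lnk - qform Q (g - v) / 2.
Proof.
rewrite /gauss_pdf lnM ?posrE ?expR_gt0 ?expRK ?mulNr//.
by rewrite invr_gt0 sqrtr_gt0 gauss_normalizer_gt0.
Qed.

Let asum_gt0 : 0 < asum.
Proof. exact: sum_ord_gt0. Qed.

Let s0_gt0 t : 0 < s0 t.
Proof.
apply: sum_ord_gt0 => j; rewrite mulr_gt0 ?divr_gt0// gauss_pdf_gt0//.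
exact: sym_posdefD.
Qed.

(** The term [ln a_sum] normalizes the concentrations inside the log-sum-exp, which becomes the
    logarithm of the posterior mean of the marginal density. *)
Lemma elbo_termE t : elbo_term Sigma mu S alpha (f t) (y t) =
  ln (gauss_pdf (mu (y t)) Sigma (f t)) - 2^-1 * \tr (Q *m S (y t))
  + digamma (alpha (y t)) - digamma asum - ln (s0 t).
Proof.
rewrite /elbo_term -/asum -/Q -addrA; congr (_ + _).
rewrite /LSE (eq_bigr (fun j => asum * (alpha j / asum *
    gauss_pdf (mu j) (Sigma + S j) (f t)))); last first.
  move=> j _; rewrite expRD !lnK ?posrE//; last first.
    by apply: gauss_pdf_gt0; exact: sym_posdefD.
  by rewrite [RHS]mulrA [asum * _]mulrC divfK ?gt_eqF// mulrC.
rewrite -mulr_sumr -/(s0 t) lnM ?posrE//.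
by rewrite opprD addrA subrr add0r.
Qed.

(* Both Jensen steps of the paper are pointwise linearizations of the
   logarithm: one at [s0 t], the posterior mean of the marginal density, and
   one at [z], the guess for the evidence. *)
Lemma elbo_le_kl_div (z Z : R) : 0 < z ->
  marginal_likelihood p Sigma f y = Z%:E ->
  ((\sum_(t < T) elbo_term Sigma mu S alpha (f t) (y t)
    - ln z - Z / z + 1)%:E <= kl_div P q p)%E.
Proof.
move=> z0 ZE.
have /choice[bA /all_and2[hA leA]] : forall t, exists b,
    nnint P (fun xi => - ln (rho_of xi (y t)) * q xi) b /\
    b <= digamma asum - digamma (alpha (y t)).
  by move=> t; have [b ? ?] := param_pdf_log_rho mu alpha_gt0 S_pd (y t); exists b.
have /choice[bB /all_and2[hB leB]] : forall t, exists b,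
    nnint P (fun xi => qform Q (f t - mu_of xi (y t)) / 2 * q xi) b /\
    b <= (qform Q (f t - mu (y t)) + \tr (Q *m S (y t))) / 2.
  move=> t.
  have [b ? ?] := param_pdf_qform mu alpha_gt0 S_pd (f t) (y t)
    (sym_posdefV Sigma_pd).
  by exists b.
have hC t : nnint P (fun xi => (s0 t)^-1 *
    \sum_j joint_pdf Sigma xi (f t) j * q xi) 1.
  have sV : 0 <= (s0 t)^-1 by rewrite invr_ge0 ltW.
  have := nnintZ sV (nnint_sum
    (fun j => nnint_joint_pdf mu alpha_gt0 S_pd (f t) j Sigma_pd)).
  by rewrite -/asum -/(s0 t) mulVf// gt_eqF.
have hL : nnint P (fun xi => L xi * p xi) Z by split.
have zV : 0 <= z^-1 by rewrite invr_ge0 ltW.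
have hN := nnintD (nnint_sum (fun t => nnintD (hA t) (nnintD (hB t) (hC t))))
  (nnintZ zV hL).
set N := fun xi => _ in hN.
(* For each [t] come the Gaussian log-normalizer and the constant of the tangent at [s0 t]; the
   final [- ln z + 1] comes from Gibbs' inequality. *)
pose K := \sum_(t < T) (lnk - ln (s0 t) + 1) - ln z + 1.
have hq := nnint_param_pdf mu alpha_gt0 S_pd.
have [Gi Gint] := integral_affine_nnint K hq hN.
rewrite kl_div_param_pdfE.
apply: (@le_trans _ _ (\int[P]_xi (K * q xi - N xi)%:E)%E).
  rewrite Gint lee_fin mulr1 /K.
  have : \sum_(t < T) (bA t + (bB t + 1)) <= \sum_(t < T) (lnk - ln (s0 t) + 1)
      - \sum_(t < T) elbo_term Sigma mu S alpha (f t) (y t).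
    rewrite -sumrB; apply: ler_sum => t _; rewrite elbo_termE ln_gauss_pdf.
    move: (leA t) (leB t); move: (digamma asum) (digamma (alpha (y t))).
    by move: (lnk) (ln (s0 t)) (qform _ _) (\tr _) (bA t) (bB t) => *; lra.
  rewrite [Z / z]mulrC; move: (\sum_(t < T) elbo_term _ _ _ _ _ _).
  move: (\sum_(t < T) (bA t + _)) (\sum_(t < T) (lnk - _ + _)) => *; lra.
apply: le_integral_integrable => //.
  apply/measurable_EFinP; have [mq _ _] := hq.
  have [mp _ _] := nnint_param_pdf mu0 alpha0_gt0 S0_pd.
  apply: measurable_funM => //; apply: measurable_funB.
    by apply: measurableT_comp => //; exact: measurable_ln.
  by apply: measurableT_comp => //; exact: measurable_ln.
move=> xi; rewrite lee_fin /N.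
(* Where [q] vanishes the minorant is [- N xi <= 0], while the divergence integrand is 0. *)
have [q0|q0] := eqVneq (q xi) 0.
  rewrite q0 mulr0 mul0r sub0r oppr_le0 addr_ge0 ?(mulr_ge0 zV (Lp_ge0 xi))//.
  apply: sumr_ge0 => t _; rewrite !mulr0 !add0r.
  by rewrite big1 ?mulr0// => j _; rewrite mulr0.
have r0 k := param_pdf_supp k q0.
have qp : 0 < q xi by exact: param_pdf_gt0.
have pp : 0 < p xi by exact: param_pdf_gt0.
have Lpos : 0 < L xi by apply: prodr_gt0 => t _; exact: class_prob_gt0.
rewrite -ln_div ?posrE//; apply: le_trans (gibbs_pointwise qp pp Lpos z0).
rewrite [in leRHS]mulrC.
rewrite opprD addrA [z^-1 * _]mulrC lerD2r.
have -> : \sum_(t < T) (- ln (rho_of xi (y t)) * q xi +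
      (qform Q (f t - mu_of xi (y t)) / 2 * q xi +
       (s0 t)^-1 * \sum_j joint_pdf Sigma xi (f t) j * q xi)) =
    q xi * \sum_(t < T) (- ln (rho_of xi (y t)) +
      (qform Q (f t - mu_of xi (y t)) / 2 +
       (\sum_j joint_pdf Sigma xi (f t) j) / s0 t)).
  rewrite mulr_sumr; apply: eq_bigr => t _; rewrite -mulr_suml.
  by rewrite !mulrDr; congr (_ + (_ + _)); ring.
rewrite [K * _]mulrC -mulrBr [leRHS]mulrC ler_pM2l//.
have lnL : ln (L xi) = \sum_(t < T) ln (class_prob Sigma xi (f t) (y t)).
  apply: expR_inj; rewrite lnK ?posrE// expR_sum; apply: eq_bigr => t _.
  by rewrite lnK// posrE class_prob_gt0.
rewrite lnL /K.
(* With the Gibbs constants and the factor [q xi] gone, only the tangent bound on the log of each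
   denominator is left. *)
suff : \sum_(t < T) (lnk - ln (s0 t) + 1) - \sum_(t < T) (- ln (rho_of xi (y t)) +
      (qform Q (f t - mu_of xi (y t)) / 2 +
       (\sum_j joint_pdf Sigma xi (f t) j) / s0 t)) <=
    \sum_(t < T) ln (class_prob Sigma xi (f t) (y t)).
  by move: (\sum_(t < T) _) (\sum_(t < T) _) (\sum_(t < T) _) => *; lra.
rewrite -sumrB; apply: ler_sum => t _.
have spos : 0 < \sum_j joint_pdf Sigma xi (f t) j.
  by apply: sum_ord_gt0 => j; exact: joint_pdf_gt0.
rewrite /class_prob ln_div ?posrE ?joint_pdf_gt0//.
rewrite {3}/joint_pdf lnM ?posrE ?gauss_pdf_gt0// ln_gauss_pdf.
have := ln_le_ratio spos (s0_gt0 t); move: (lnk) (ln (s0 t)) (_ / s0 t).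
by move: (ln (rho_of _ _)) (ln (\sum_j _)) (qform _ _) => *; lra.
Qed.

End bound.

End elbo.

Theorem theorem3 (R : realType) (Theta : Type) (Nx Nphi Ny T : nat)
    (phi : 'cV[R]_Nx -> Theta -> 'cV[R]_Nphi) (theta : Theta)
    (x : 'I_T -> 'cV[R]_Nx) (y : 'I_T -> 'I_Ny)
    (alpha0 : 'I_Ny -> R) (mu0 : 'I_Ny -> 'cV[R]_Nphi)
    (S0 : 'I_Ny -> 'M[R]_Nphi) (Sigma : 'M[R]_Nphi)
    (mu : 'I_Ny -> 'cV[R]_Nphi) (S : 'I_Ny -> 'M[R]_Nphi) :
  (0 < T)%N ->
  (forall k, 0 < alpha0 k) ->
  (forall k, sym_posdef (S0 k)) ->
  sym_posdef Sigma ->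
  (forall k, sym_posdef (S k)) ->
  let f := fun t => phi (x t) theta in
  let alpha := posterior_conc alpha0 y in
  let p := param_pdf alpha0 mu0 S0 in
  let q := param_pdf alpha mu S in
  ((elbo_likelihood Sigma mu S alpha f y)%:E
     - T%:R^-1%:E * kl_div (param_measure R Nphi Ny) q p
   <= T%:R^-1%:E * lne (marginal_likelihood p Sigma f y))%E.
Proof.
case: Ny y alpha0 mu0 S0 mu S => [|n] y alpha0 mu0 S0 mu S
    T0 a0 S0_pd Sigma_pd S_pd; cbv zeta.
  (* Since [T] is positive some label exists, which rules out zero classes. *)
  by have := ltn_ord (y (Ordinal T0)); rewrite ltn0.
set f := fun t => _; set alpha := posterior_conc _ _.
set p := param_pdf alpha0 _ _; set q := param_pdf alpha _ _.
have alpha_gt0 k : 0 < alpha k by rewrite ltr_wpDr.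
have bound z Z := @elbo_le_kl_div R n Nphi T alpha0 alpha mu0 mu S0 S Sigma f y
  a0 alpha_gt0 S0_pd S_pd Sigma_pd z Z.
have TV0 : 0 < T%:R^-1 :> R by rewrite invr_gt0 ltr0n.
rewrite /elbo_likelihood -/q -/p in bound *.
set E := \sum_(t < T) _ in bound *.
set kl := kl_div _ _ _ in bound *.
have evidence_ge0 : (0 <= marginal_likelihood p Sigma f y)%E.
  apply: integral_ge0 => xi _; rewrite lee_fin.
  have [->|p0] := eqVneq (p xi) 0; first by rewrite mulr0.
  have r0 k := param_pdf_supp k p0.
  apply: mulr_ge0; last exact/ltW/param_pdf_gt0.
  by apply: prodr_ge0 => t _; exact/ltW/class_prob_gt0.
case ZE : marginal_likelihood evidence_ge0 => [Z| |//]; last first.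
  by move=> _; rewrite [lne _]/= gt0_muley ?lte_fin// leey.
rewrite lee_fin le_eqVlt => /orP[/eqP Z0|Z0].
  (* Zero evidence: letting the guess tend to 0 forces an infinite divergence. *)
  suff -> : kl = +oo%E by rewrite gt0_muley ?lte_fin// addeNy leNye.
  case klE : kl => [k|//|].
    (* For this guess and [Z = 0] the bound reads [k + 1 <= k]. *)
    have := bound (expR (E - k)) Z (expR_gt0 _) ZE.
    by rewrite klE -Z0 mul0r expRK lee_fin => ?; exfalso; lra.
  by have := bound 1 Z ltr01 ZE; rewrite klE.
(* With the true evidence as guess, [Z / z] cancels the constant 1. *)
have := bound Z Z Z0 ZE; rewrite divff ?gt_eqF// lne_EFin//.
case: (kl) => [k| |//]; last by move=> _; rewrite gt0_muley ?lte_fin// addeNy leNye.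
rewrite lee_fin => Ek; rewrite -!EFinM -EFinB lee_fin -mulrBr ler_pM2l//.
by lra.
Qed.
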